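(* Let $\mathcal F:\mathbb R^n\to\mathbb R^m$ be a measurable forward model, $\boldsymbol C_\varepsilon\in\mathbb R^{m\times m}$ symmetric positive definite, $\pi$ a prior probability density on $\mathbb R^n$, $Y\in\mathbb R^m$ fixed data, $\boldsymbol\Pi_r\in\mathbb R^{n\times n}$ a linear projector of rank $r$, $1\le r<n$, and $N\ge1$ an integer. Let $P$ be the posterior, $P_{\Pi_r}$ the approximate posterior built with the marginalized likelihood $\mathcal L_{\Pi_r}$, $\omega=\mathcal L/\mathcal L_{\Pi_r}$ the corresponding weights, and $P_{\Pi_r}^{(N)}$ the numerically approximated posterior obtained by replacing $\mathcal L_{\Pi_r}$ with its $N$-sample Monte Carlo approximation $\mathcal L_{\Pi_r}^{(N)}$ (all defined in the context). Then the expectation over the Monte Carlo draws of the squared Hellinger distance between $P$ and $P_{\Pi_r}^{(N)}$ satisfies $$\mathbb E_{MC}\left(d_H(P,P_{\Pi_r}^{(N)})^2\right)\le 1-\sqrt{1-\mathrm{Var}_{P_{\Pi_r}}\left(\sqrt{\omega(X)}\right)}+\frac{2}{N}\,\mathbb E_{P_{\Pi_r}}\left(\mathrm{Var}_{\pi_{\perp|r}}(\omega(X))\right).$$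
   Context: Observation model: $Y=\mathcal F(X)+\boldsymbol\varepsilon$ with $\boldsymbol\varepsilon\sim\mathcal N(0,\boldsymbol C_\varepsilon)$. Likelihood: $\mathcal L(\boldsymbol x)=(2\pi)^{-m/2}\det(\boldsymbol C_\varepsilon)^{-1/2}\exp\left(-\tfrac12(\mathcal F(\boldsymbol x)-Y)^\top\boldsymbol C_\varepsilon^{-1}(\mathcal F(\boldsymbol x)-Y)\right)$. Posterior density: $P(\boldsymbol x)=\mathcal L(\boldsymbol x)\pi(\boldsymbol x)/\pi_{\mathrm{data}}$ with $\pi_{\mathrm{data}}=\int_{\mathbb R^n}\mathcal L(\boldsymbol x)\pi(\boldsymbol x)\,d\boldsymbol x$. Decomposition: $\boldsymbol V_r\in\mathbb R^{n\times r}$ and $\boldsymbol V_\perp\in\mathbb R^{n\times(n-r)}$ have columns forming bases of $\mathrm{Im}(\boldsymbol\Pi_r)$ and $\mathrm{Ker}(\boldsymbol\Pi_r)$ respectively. Every $\boldsymbol x\in\mathbb R^n$ is written uniquely as $\boldsymbol x=\boldsymbol V_r\boldsymbol z_r+\boldsymbol V_\perp\boldsymbol z_\perp$, with $\boldsymbol V_r\boldsymbol z_r=\boldsymbol\Pi_r\boldsymbol x$ and $\boldsymbol V_\perp\boldsymbol z_\perp=(\mathrm I_n-\boldsymbol\Pi_r)\boldsymbol x$. For $X\sim\pi$, $\pi_{\perp|r}(\cdot|\boldsymbol z_r)$ denotes the conditional density of $Z_\perp$ given $Z_r=\boldsymbol z_r$. Approximate likelihood: $\mathcal L_{\Pi_r}(\boldsymbol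 z_r)=\int_{\mathbb R^{n-r}}\mathcal L(\boldsymbol V_r\boldsymbol z_r+\boldsymbol V_\perp\boldsymbol z_\perp)\,\pi_{\perp|r}(\boldsymbol z_\perp|\boldsymbol z_r)\,d\boldsymbol z_\perp$. Approximate posterior density: $P_{\Pi_r}(\boldsymbol x)=\mathcal L_{\Pi_r}(\boldsymbol z_r)\pi(\boldsymbol x)/\pi_{\mathrm{data}}$ (the normalization constant is the same as that of $P$). Weights: $\omega(\boldsymbol x)=P(\boldsymbol x)/P_{\Pi_r}(\boldsymbol x)=\mathcal L(\boldsymbol x)/\mathcal L_{\Pi_r}(\boldsymbol z_r)$. Monte Carlo approximation: $\mathcal L_{\Pi_r}^{(N)}(\boldsymbol z_r)=\frac1N\sum_{i=1}^N\mathcal L(\boldsymbol V_r\boldsymbol z_r+\boldsymbol V_\perp\boldsymbol z^{(i)})$ where, for each $\boldsymbol z_r$, $\boldsymbol z^{(1)},\dots,\boldsymbol z^{(N)}$ are i.i.d. with density $\pi_{\perp|r}(\cdot|\boldsymbol z_r)$; the draws may depend on $\boldsymbol z_r$, and the map (random outcome, $\boldsymbol z_r$) $\mapsto(\boldsymbol z^{(i)})_i$ is taken to be jointly measurable. $P_{\Pi_r}^{(N)}$ is the random probability density on $\mathbb R^n$ proportional to $\boldsymbol x\mapsto\mathcal L_{\Pi_r}^{(N)}(\boldsymbol z_r)\,\pi(\boldsymbol x)$. $\mathbb E_{MC}$ denotes expectation with respect to the Monte Carlo draws. Hellinger distance between probability densities $p,q$ on $\mathbb R^n$: $d_H(p,q)^2=\tfrac12\int_{\mathbb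 R^n}\left(\sqrt{p(\boldsymbol x)}-\sqrt{q(\boldsymbol x)}\right)^2d\boldsymbol x$. $\mathbb E_{P_{\Pi_r}}$ and $\mathrm{Var}_{P_{\Pi_r}}$ denote expectation and variance when $X\sim P_{\Pi_r}$. $\mathrm{Var}_{\pi_{\perp|r}}(\omega(X))$ is the conditional variance, as a function of $\boldsymbol z_r$, of $\omega(\boldsymbol V_r\boldsymbol z_r+\boldsymbol V_\perp Z_\perp)$ with $Z_\perp\sim\pi_{\perp|r}(\cdot|\boldsymbol z_r)$; it takes values in $[0,+\infty]$. *)

(* Defs.v *)
From HB Require Import structures.
From mathcomp Require Import all_boot all_order all_algebra.
From mathcomp Require Import all_classical all_reals all_analysis.

Set Implicit Arguments.
Unset Strict Implicit.
Unset Printing Implicit Defensive.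

Import Order.TTheory GRing.Theory Num.Theory.
Import numFieldNormedType.Exports.

Local Open Scope classical_set_scope.
Local Open Scope ring_scope.

(* R^n is 'cV[R]_n with the sigma-algebra generated by the coordinate maps,
   that is, the Borel sigma-algebra of R^n. *)
Section measurable_cV.
Context {R : realType} (n : nat).

Let coord : 'I_n -> 'cV[R]_n -> R := fun i x => x i ord0.

Let cV_set0 : g_sigma_preimage coord set0.
Proof. exact: sigma_algebra0. Qed.

Let cV_setC A : g_sigma_preimage coord A -> g_sigma_preimage coord (~` A).
Proof. exact: sigma_algebraC. Qed.

Let cV_bigcup (F : _^nat) : (forall i, g_sigma_preimage coord (F i)) ->
  g_sigma_preimage coord (\bigcup_i (F i)).
Proof. exact: sigma_algebra_bigcup. Qed.

HB.instance Definition _ := @isMeasurable.Build default_measure_display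
  'cV[R]_n (g_sigma_preimage coord) cV_set0 cV_setC cV_bigcup.

End measurable_cV.

Section measurable_cV_lemmas.
Context {R : realType}.

Lemma measurable_coord n (i : 'I_n) :
  measurable_fun [set: 'cV[R]_n] (fun x : 'cV[R]_n => x i ord0).
Proof.
move=> _ Y mY; rewrite setTI; apply: sub_sigma_algebra => /=.
rewrite -bigcup_seq/=; exists i => /=; first by rewrite mem_index_enum.
by exists Y => //; rewrite setTI.
Qed.

Lemma measurable_cVP d (T : measurableType d) n (f : T -> 'cV[R]_n) :
  (forall i, measurable_fun [set: T] (fun t => f t i ord0)) ->
  measurable_fun [set: T] f.
Proof.
move=> mf.
have sub : g_sigma_preimage (fun i (t : T) => f t i ord0) `<=` measurable.
  apply: smallest_sub; first exact: sigma_algebra_measurable.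
  case: n => [|n] in f mf *; first by rewrite big_ord0.
  rewrite -bigcup_mkord_ord; apply: bigcup_sub => i Ii.
  by move=> A [B mB <-]; exact: mf.
move=> _ A mA; apply: sub.
rewrite (@g_sigma_preimage_comp _ R n _ (fun i (x : 'cV[R]_n) => x i ord0)).
by exists A.
Qed.

Definition cons_cV n (p : measurableTypeR R * 'cV[R]_n) : 'cV[R]_n.+1 :=
  \col_i (if unlift ord0 i is Some j then p.2 j ord0 else p.1).

Definition uncons_cV n (x : 'cV[R]_n.+1) : measurableTypeR R * 'cV[R]_n :=
  (x ord0 ord0, \col_j x (lift ord0 j) ord0).

Lemma cons_cV0 n p : @cons_cV n p ord0 ord0 = p.1.
Proof. by rewrite mxE unlift_none. Qed.

Lemma cons_cVS n p i : @cons_cV n p (lift ord0 i) ord0 = p.2 i ord0.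
Proof. by rewrite mxE liftK. Qed.

Lemma cons_cVK n : cancel (@cons_cV n) (@uncons_cV n).
Proof.
move=> [a x]; congr pair; first exact: cons_cV0.
by apply/colP => j; rewrite mxE cons_cVS.
Qed.

Lemma measurable_cons_cV n : measurable_fun setT (@cons_cV n).
Proof.
apply: measurable_cVP => i; case: (unliftP ord0 i) => [j|] ->.
  under eq_fun do rewrite cons_cVS.
  exact: (measurableT_comp (measurable_coord j) measurable_snd).
under eq_fun do rewrite cons_cV0.
exact: measurable_fst.
Qed.

Lemma measurable_uncons_cV n : measurable_fun setT (@uncons_cV n).
Proof.
apply: measurable_fun_pair; first exact: measurable_coord.
apply: measurable_cVP => i; under eq_fun do rewrite mxE.
exact: measurable_coord.
Qed.

Section step.
Variables (n : nat) (mu : {sigma_finite_measure set 'cV[R]_n -> \bar R}).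

Definition lebesgue_step : set 'cV[R]_n.+1 -> \bar R :=
  pushforward (lebesgue_measure \x mu)%E (@cons_cV n).

Let lebesgue_step0 : lebesgue_step set0 = 0%E.
Proof. by rewrite /lebesgue_step /pushforward preimage_set0 measure0. Qed.

Let lebesgue_step_ge0 A : (0 <= lebesgue_step A)%E.
Proof. exact: (measure_ge0 (lebesgue_measure \x mu)%E). Qed.

Let lebesgue_step_sigma_additive : semi_sigma_additive lebesgue_step.
Proof.
have mc := @measurable_cons_cV n.
move=> F mF tF mUF; rewrite /lebesgue_step /pushforward preimage_bigcup.
apply: measure_semi_sigma_additive.
- by move=> k; rewrite -[X in measurable X]setTI; exact: mc.
- apply/trivIsetP => /= i j _ _ ij; rewrite -preimage_setI.
  by move/trivIsetP : tF => /(_ _ _ _ _ ij) ->//; rewrite preimage_set0.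
- by rewrite -preimage_bigcup -[X in measurable X]setTI; exact: mc.
Qed.

HB.instance Definition _ := isMeasure.Build _ _ _ lebesgue_step
  lebesgue_step0 lebesgue_step_ge0 lebesgue_step_sigma_additive.

Let lebesgue_step_sigma_finite : sigma_finite setT lebesgue_step.
Proof.
have mu' := @measurable_uncons_cV n.
have /sigma_finiteP[F [TF ndF Foo]] := sigma_finiteT (@lebesgue_measure R).
have /sigma_finiteP[G [TG ndG Goo]] := sigma_finiteT mu.
exists (fun k => @uncons_cV n @^-1` (F k `*` G k)).
  rewrite -preimage_bigcup (_ : \bigcup_k _ = setT) ?preimage_setT//.
  rewrite -setXTT TF TG predeqE => -[x y]; split.
    by move=> [k _ []/= ? ?]; split; exists k.
  move=> [/= [k _ Fkx] [l _ Gly]]; exists (maxn k l) => //; split.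
  - by move: x Fkx; exact/subsetPset/ndF/leq_maxl.
  - by move: y Gly; exact/subsetPset/ndG/leq_maxr.
move=> k; have [mF Fk] := Foo k; have [mG Gk] := Goo k; split.
  by rewrite -[X in measurable X]setTI; apply: mu' => //; exact: measurableX.
rewrite /lebesgue_step /pushforward (_ : _ @^-1` _ = F k `*` G k).
  by rewrite product_measure1E// lte_mul_pinfty// ge0_fin_numE.
by apply/seteqP; split=> p; rewrite /preimage /mkset cons_cVK.
Qed.

HB.instance Definition _ := Measure_isSigmaFinite.Build _ _ _ lebesgue_step
  lebesgue_step_sigma_finite.

End step.

(* Lebesgue measure on R^n; R^0 is a point of mass 1. *)
Fixpoint lebesgue_cV n : {sigma_finite_measure set 'cV[R]_n -> \bar R} :=
  if n is k.+1 return {sigma_finite_measure set 'cV[R]_n -> \bar R}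
  then lebesgue_step (lebesgue_cV k) else \d_(0 : 'cV[R]_0).

Lemma lebesgue_cV_box n (A : 'I_n -> set R) : (forall i, measurable (A i)) ->
  lebesgue_cV n [set x | forall i, A i (x i ord0)] =
  (\prod_(i < n) lebesgue_measure (A i))%E.
Proof.
elim: n A => [|n IHn] A mA.
  by rewrite big_ord0 /= diracE mem_set// => -[].
rewrite big_ord_recl -IHn//= /lebesgue_step /pushforward.
rewrite (_ : _ @^-1` _ = A ord0 `*`
    [set x : 'cV[R]_n | forall i, A (lift ord0 i) (x i ord0)]).
  rewrite product_measure1E//.
    exact: mA.
  rewrite (_ : [set _ | _] =
      \bigcap_(i in [set: 'I_n]) ((fun x : 'cV[R]_n => x i ord0) @^-1` A (lift ord0 i))).
    apply: fin_bigcap_measurable; first exact: finite_finset.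
    by move=> i _; rewrite -[X in measurable X]setTI; exact: measurable_coord.
  by apply/seteqP; split=> x /= Ax i; [move=> _; exact: Ax|exact: Ax].
apply/seteqP; split=> p /=.
  move=> Ap; split=> [|i]; first by have := Ap ord0; rewrite cons_cV0.
  by have := Ap (lift ord0 i); rewrite cons_cVS.
move=> [Ap0 Ap] i; case: (unliftP ord0 i) => [j|] ->.
  by rewrite cons_cVS.
by rewrite cons_cV0.
Qed.

End measurable_cV_lemmas.

Section densities.
Context {R : realType}.

Definition is_pdf n (p : 'cV[R]_n -> R) :=
  [/\ measurable_fun setT p, forall x, 0 <= p x &
      (\int[lebesgue_cV n]_x (p x)%:E)%E = 1%E].

(* E(f(X)) for X with density p *)
Definition pdf_expectation n (p : 'cV[R]_n -> R) (f : 'cV[R]_n -> \bar R) :=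
  (\int[lebesgue_cV n]_x (f x * (p x)%:E))%E.

(* Var(f(X)) for X with density p *)
Definition pdf_variance n (p : 'cV[R]_n -> R) (f : 'cV[R]_n -> R) :=
  let mean := fine (pdf_expectation p (EFin \o f)) in
  pdf_expectation p (fun x => ((f x - mean) ^+ 2)%:E).

Definition hellinger_sq n (p q : 'cV[R]_n -> R) : \bar R :=
  ((2^-1)%:E *
   \int[lebesgue_cV n]_x ((Num.sqrt (p x) - Num.sqrt (q x)) ^+ 2)%:E)%E.

Definition has_pdf d (T : measurableType d) (Q : probability T R)
    n (X : T -> 'cV[R]_n) (p : 'cV[R]_n -> R) :=
  forall B, measurable B ->
    Q (X @^-1` B) = (\int[lebesgue_cV n]_(x in B) (p x)%:E)%E.

(* Taking B i = setT for i outside a subfamily gives the product rule for that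
   subfamily. *)
Definition mutually_independent d (T : measurableType d) (Q : probability T R)
    n N (X : 'I_N -> T -> 'cV[R]_n) :=
  forall B : 'I_N -> set 'cV[R]_n, (forall i, measurable (B i)) ->
    Q (\bigcap_i (X i @^-1` B i)) =
    (\prod_(i < N) Q (X i @^-1` B i))%E.

Definition iid_pdf d (T : measurableType d) (Q : probability T R)
    n N (X : 'I_N -> T -> 'cV[R]_n) (p : 'cV[R]_n -> R) :=
  mutually_independent Q X /\ forall i, has_pdf Q (X i) p.

End densities.

Section linear_decomposition.
Context {R : realType}.

Definition symmetric_posdef m (C : 'M[R]_m) :=
  C^T = C /\ forall v : 'cV[R]_m, v != 0 -> 0 < (v^T *m C *m v) ord0 ord0.

(* mxalgebra works with row spaces and row kernels: the columns of V are the
   rows of V^T, Im(A) is the row space of A^T, and Ker(A) is the row space of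
   kermx A^T. *)
Definition basis_of_image n k (V : 'M[R]_(n, k)) (A : 'M[R]_n) :=
  row_free V^T && (V^T == A^T)%MS.

Definition basis_of_kernel n k (V : 'M[R]_(n, k)) (A : 'M[R]_n) :=
  row_free V^T && (V^T == kermx A^T)%MS.

(* The coordinates of y in the columns of V, for y in their span *)
Definition coords n k (V : 'M[R]_(n, k)) (y : 'cV[R]_n) : 'cV[R]_k :=
  (y^T *m pinvmx V^T)^T.

Definition coord_r n r (Pi : 'M[R]_n) (V_r : 'M[R]_(n, r)) (x : 'cV[R]_n) :=
  coords V_r (Pi *m x).

Definition coord_perp n s (Pi : 'M[R]_n) (V_perp : 'M[R]_(n, s))
    (x : 'cV[R]_n) :=
  coords V_perp ((1%:M - Pi) *m x).

Lemma coordsK n k (V : 'M[R]_(n, k)) y :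
  (y^T <= V^T)%MS -> V *m coords V y = y.
Proof.
by move=> yV; apply: trmx_inj; rewrite trmx_mul trmxK mulmxKpV.
Qed.

Lemma coord_rE n r (Pi : 'M[R]_n) (V_r : 'M[R]_(n, r)) x :
  basis_of_image V_r Pi -> V_r *m coord_r Pi V_r x = Pi *m x.
Proof.
move=> /andP[_ /eqmxP VPi]; apply: coordsK.
by rewrite VPi trmx_mul submxMl.
Qed.

Lemma coord_perpE n s (Pi : 'M[R]_n) (V_perp : 'M[R]_(n, s)) x :
  Pi *m Pi = Pi -> basis_of_kernel V_perp Pi ->
  V_perp *m coord_perp Pi V_perp x = (1%:M - Pi) *m x.
Proof.
move=> PiPi /andP[_ /eqmxP VPi]; apply: coordsK.
rewrite VPi; apply/sub_kermxP.
by rewrite -trmx_mul mulmxA mulmxBr mulmx1 PiPi subrr mul0mx trmx0.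
Qed.

End linear_decomposition.

Section bayes.
Context {R : realType}.

Definition likelihood n m (F : 'cV[R]_n -> 'cV[R]_m) (C : 'M[R]_m)
    (Y : 'cV[R]_m) (x : 'cV[R]_n) : R :=
  (2 * pi) `^ (- (m%:R / 2)) * (\det C) `^ (- 2^-1) *
  expR (- 2^-1 * ((F x - Y)^T *m invmx C *m (F x - Y)) ord0 ord0).

Variables (n r s : nat) (Pi : 'M[R]_n).
Variables (V_r : 'M[R]_(n, r)) (V_perp : 'M[R]_(n, s)).
Variables (prior : 'cV[R]_n -> R) (L : 'cV[R]_n -> R).
(* cond_pdf z_r is the density pi_{perp|r}( . | z_r) *)
Variable cond_pdf : 'cV[R]_r -> 'cV[R]_s -> R.

Local Notation z_r := (coord_r Pi V_r).
Local Notation z_perp := (coord_perp Pi V_perp).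

(* For X ~ prior, cond_pdf is a (version of the) conditional density of
   Z_perp = z_perp X given Z_r = z_r X: a jointly measurable family of
   densities such that
   P(Z_r \in A, Z_perp \in B) = E(1_A(Z_r) \int_B cond_pdf Z_r z dz). *)
Definition is_conditional_pdf :=
  [/\ measurable_fun setT
        (fun z : 'cV[R]_r * 'cV[R]_s => cond_pdf z.1 z.2),
      forall zr, is_pdf (cond_pdf zr) &
      forall (A : set 'cV[R]_r) (B : set 'cV[R]_s),
        measurable A -> measurable B ->
        (\int[lebesgue_cV n]_(x in z_r @^-1` A `&` z_perp @^-1` B) (prior x)%:E =
         \int[lebesgue_cV n]_(x in z_r @^-1` A)
           ((\int[lebesgue_cV s]_(z in B) (cond_pdf (z_r x) z)%:E) *
            (prior x)%:E))%E].

Definition evidence : R := \int[lebesgue_cV n]_x (L x * prior x).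

Definition posterior (x : 'cV[R]_n) : R := L x * prior x / evidence.

Definition marginal_likelihood (zr : 'cV[R]_r) : R :=
  \int[lebesgue_cV s]_z (L (V_r *m zr + V_perp *m z) * cond_pdf zr z).

Definition approx_posterior (x : 'cV[R]_n) : R :=
  marginal_likelihood (z_r x) * prior x / evidence.

Definition weight (x : 'cV[R]_n) : R := L x / marginal_likelihood (z_r x).

Definition cond_variance_weight (zr : 'cV[R]_r) : \bar R :=
  pdf_variance (cond_pdf zr) (fun z => weight (V_r *m zr + V_perp *m z)).

(* draws zr is the sample z^(1), ..., z^(N) used at z_r = zr *)
Variables (N : nat) (draws : 'cV[R]_r -> N.-tuple 'cV[R]_s).

Definition mc_likelihood (zr : 'cV[R]_r) : R :=
  N%:R^-1 * \sum_(i < N) L (V_r *m zr + V_perp *m tnth (draws zr) i).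

Definition mc_posterior (x : 'cV[R]_n) : R :=
  mc_likelihood (z_r x) * prior x /
  \int[lebesgue_cV n]_y (mc_likelihood (z_r y) * prior y).

End bayes.

(* Main.v *)
Require Import Defs.
From HB Require Import structures.
From mathcomp Require Import all_boot all_order all_algebra.
From mathcomp Require Import all_classical all_reals all_analysis.
From mathcomp Require Import measurable_realfun.
From mathcomp Require Import ring lra.

Set Implicit Arguments.
Unset Strict Implicit.
Unset Printing Implicit Defensive.

Import Order.TTheory GRing.Theory Num.Theory.
Import numFieldNormedType.Exports.

Local Open Scope classical_set_scope.
Local Open Scope ring_scope.

(** Write [P = omega P_r] for the posterior and
    [W = mc_likelihood / marginal_likelihood], a function of [z_r x], so that
    the Monte Carlo posterior is [W P_r / T] with [T] the integral of
    [W P_r].  At each [z_r] the ratio [W] is the mean of [N] independent copies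
    of the weight, hence it has mean 1 and variance [Var(omega) / N] under the
    Monte Carlo draws, [Var(omega)] being the conditional variance
    ([relative_likelihood_mean], [relative_likelihood_variance]).

    With [G] the integral of [sqrt (P P_r)], the squared Hellinger distance of
    [P] and [P_r] is [1 - G], and the variance of [sqrt omega] under [P_r] is
    [1 - G ^ 2] ([variance_sqrt_weight]); so the first two terms of the bound
    are [1 - G].

    It remains to see that the draws cost at most [V], the integral of
    [Var(omega) / N] against [P_r], which is half of what is allowed.  The
    integrand of the Hellinger distance of [P] and [W P_r / T] is expanded to
    second order in [W - 1] and [T - 1] ([hellinger_reweighted_le]).  The terms
    of first order vanish in expectation because [W] and [T] have mean 1, and
    those of second order are bounded by the integrals of [(W - 1) ^ 2] against
    [P] and [P_r]; for [(T - 1) ^ 2] this is Jensen's inequality.  The two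
    integrals have the same expectation [V], because [z_r] has the same law
    under [P] and [P_r] ([marginalization]), which is where the conditional
    density enters.  Nothing is assumed about the joint law of the draws at
    different values of [z_r].  All integrands are arranged to be nonnegative,
    so that Tonelli's theorem applies with no integrability condition, [V]
    being possibly infinite. *)

(** * Integration against densities *)

Section change_of_density.
Local Open Scope ereal_scope.
Context d (T : measurableType d) (R : realType).
Variables (mu nu : {measure set T -> \bar R}) (f : T -> R).
Hypotheses (mf : measurable_fun [set: T] f) (f0 : forall x, (0 <= f x)%R).
Hypothesis nuE : forall A, measurable A -> nu A = \int[mu]_(x in A) (f x)%:E.

Import HBNNSimple.

Let mEf : measurable_fun [set: T] (EFin \o f).
Proof. exact/measurable_EFinP. Qed.

Let sintegral_density (h : {nnsfun T >-> R}) :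
  \int[nu]_x (h x)%:E = \int[mu]_x ((h x)%:E * (f x)%:E).
Proof.
transitivity (\sum_(k \in range h) k%:E *
    \int[mu]_x ((\1_(h @^-1` [set k]) x)%:E * (f x)%:E)).
  rewrite integralT_nnsfun sintegralE; apply: eq_fsbigr => k _.
  rewrite nuE// integral_mkcond; congr (_ * _); apply: eq_integral => x _.
  by rewrite patchE indicE; case: ifPn => xk; rewrite ?mul1e ?mul0e.
have m1 k : measurable_fun [set: T]
    (fun x => (\1_(h @^-1` [set k]) x)%:E * (f x)%:E).
  by apply: emeasurable_funM => //; exact/measurable_EFinP.
under [RHS]eq_integral => x _.
  rewrite (_ : (h x)%:E * (f x)%:E =
      \sum_(k \in range h) k%:E * ((\1_(h @^-1` [set k]) x)%:E * (f x)%:E)).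
    over.
  rewrite fimfunE -fsumEFin// ge0_mule_fsuml.
    by apply: eq_fsbigr => k _; rewrite EFinM muleA.
  by move=> r; rewrite EFinM nnfun_muleindic_ge0.
rewrite ge0_integral_fsum//.
- apply: eq_fsbigr => k /[!inE] -[x _ <-]; rewrite ge0_integralZl// ?lee_fin//.
  by move=> y _; rewrite mule_ge0// lee_fin.
- by move=> k; exact: measurable_funeM.
- move=> k x _; rewrite muleA mule_ge0 ?lee_fin//.
  exact: nnfun_muleindic_ge0.
Qed.

(** The change of measure formula for a measure with density [f]. *)
Lemma ge0_integral_density (g : T -> \bar R) :
  measurable_fun [set: T] g -> (forall x, 0 <= g x) ->
  \int[nu]_x g x = \int[mu]_x (g x * (f x)%:E).
Proof.
move=> mg g0; pose g_ := nnsfun_approx measurableT mg.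
have g_cvg x : (g_ n x)%:E @[n --> \oo] --> g x.
  by apply: (cvg_nnsfun_approx (D := [set: T])).
have nd_g x : nondecreasing_seq (fun n => (g_ n x)%:E).
  by move=> m n mn; rewrite lee_fin; exact/lefP/nd_nnsfun_approx.
have mg_ n : measurable_fun [set: T] (EFin \o g_ n) by exact/measurable_EFinP.
transitivity (limn (fun n => \int[nu]_x (g_ n x)%:E)).
  rewrite -monotone_convergence//.
    by apply: eq_integral => x _; exact/esym/cvg_lim.
  by move=> n x _; rewrite lee_fin.
transitivity (limn (fun n => \int[mu]_x ((g_ n x)%:E * (f x)%:E))).
  by congr (limn _); apply/funext => n; exact: sintegral_density.
rewrite -monotone_convergence//.
- by apply: eq_integral => x _; apply/cvg_lim => //; exact: cvgeZr.
- by move=> n; apply: emeasurable_funM => //; exact: mg_.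
- by move=> n x _; rewrite mule_ge0// lee_fin.
- by move=> x _ m n mn; rewrite lee_wpmul2r ?lee_fin//; exact: nd_g.
Qed.

End change_of_density.

Section density_measure.
Local Open Scope ereal_scope.
Context d (T : measurableType d) (R : realType).
Variables (mu : {measure set T -> \bar R}) (f : T -> R).
Hypotheses (mf : measurable_fun [set: T] f) (f0 : forall x, (0 <= f x)%R).

(** The measure with density [f] with respect to [mu].  The proofs of
    measurability and nonnegativity are arguments, unused in the body, so that
    the measure structure can be inferred from the term. *)
Definition density_measure of measurable_fun [set: T] f &
    (forall x, (0 <= f x)%R) :=
  fun A : set T => \int[mu]_(x in A) (f x)%:E.

Let density0 : density_measure mf f0 set0 = 0.
Proof. by rewrite /density_measure integral_set0. Qed.

Let density_ge0 A : 0 <= density_measure mf f0 A.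
Proof. by apply: integral_ge0 => x _; rewrite lee_fin. Qed.

Let density_sigma_additive : semi_sigma_additive (density_measure mf f0).
Proof.
apply: semi_sigma_additive_nng_induced; first exact/measurable_EFinP.
by move=> x; rewrite lee_fin.
Qed.

HB.instance Definition _ := isMeasure.Build _ _ _ (density_measure mf f0)
  density0 density_ge0 density_sigma_additive.

Lemma ge0_integral_density_measure (g : T -> \bar R) :
  measurable_fun [set: T] g -> (forall x, 0 <= g x) ->
  \int[density_measure mf f0]_x g x = \int[mu]_x (g x * (f x)%:E).
Proof. by move=> mg g0; exact: ge0_integral_density. Qed.

End density_measure.

(** * Laws of random vectors *)

Section law.
Local Open Scope ereal_scope.
Context d (T : measurableType d) (R : realType) (Q : probability T R).

(** The law of the unconscious statistician *)
Lemma has_pdf_integral n (X : T -> 'cV[R]_n) p (g : 'cV[R]_n -> \bar R) :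
  measurable_fun [set: T] X -> has_pdf Q X p ->
  measurable_fun [set: 'cV[R]_n] p -> (forall x, (0 <= p x)%R) ->
  measurable_fun [set: 'cV[R]_n] g -> (forall x, 0 <= g x) ->
  \int[Q]_w g (X w) = \int[lebesgue_cV n]_x (g x * (p x)%:E).
Proof.
move=> mX Xp mp p0 mg g0.
pose X' : {RV Q >-> 'cV[R]_n} := HB.pack X (isMeasurableFun.Build _ _ _ _ _ mX).
rewrite -(ge0_integral_distribution X')//.
exact: (ge0_integral_density (nu := distribution Q X') mp p0).
Qed.

(** The rule for subfamilies at [{i, j}]: the other events are taken to be
    sure. *)
Lemma independent_pair n N (X : 'I_N -> T -> 'cV[R]_n) i j
    (A B : set 'cV[R]_n) :
  mutually_independent Q X -> i != j -> measurable A -> measurable B ->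
  Q (X i @^-1` A `&` X j @^-1` B) = Q (X i @^-1` A) * Q (X j @^-1` B).
Proof.
move=> indX ij mA mB.
pose C k := if k == i then A else if k == j then B else [set: 'cV[R]_n].
have ji : (j == i) = false by rewrite eq_sym (negbTE ij).
have mC k : measurable (C k) by rewrite /C; case: ifP => // _; case: ifP.
transitivity (Q (\bigcap_k (X k @^-1` C k))).
  congr (Q _); apply/seteqP; split=> w /=.
    move=> [Aw Bw] k _; rewrite /C; case: eqP => [->//|_].
    by case: eqP => [->//|_].
  by move=> Cw; have := Cw i I; have := Cw j I; rewrite /C/= !eqxx ji.
rewrite indX// (bigD1 i)//= (bigD1 j) /=; last by rewrite eq_sym.
rewrite big1 ?mule1; first by rewrite /C !eqxx ji.
move=> k /andP[ki kj].
by rewrite /C (negbTE ki) (negbTE kj) preimage_setT probability_setT.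
Qed.

Lemma independent_integralM n N (X : 'I_N -> T -> 'cV[R]_n) i j
    (f g : 'cV[R]_n -> \bar R) :
  (forall k, measurable_fun [set: T] (X k)) ->
  mutually_independent Q X -> i != j ->
  measurable_fun [set: 'cV[R]_n] f -> (forall x, 0 <= f x) ->
  measurable_fun [set: 'cV[R]_n] g -> (forall x, 0 <= g x) ->
  \int[Q]_w (f (X i w) * g (X j w)) =
  (\int[Q]_w f (X i w)) * (\int[Q]_w g (X j w)).
Proof.
move=> mX indX ij mf f0 mg g0.
pose Xi : {RV Q >-> 'cV[R]_n} := HB.pack (X i)
  (isMeasurableFun.Build _ _ _ _ _ (mX i)).
pose Xj : {RV Q >-> 'cV[R]_n} := HB.pack (X j)
  (isMeasurableFun.Build _ _ _ _ _ (mX j)).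
have mXij : measurable_fun [set: T] (fun w => (X i w, X j w)).
  exact: measurable_fun_pair.
pose h (z : 'cV[R]_n * 'cV[R]_n) := f z.1 * g z.2.
have mh : measurable_fun [set: 'cV[R]_n * 'cV[R]_n] h.
  apply: emeasurable_funM.
    exact: (measurableT_comp mf measurable_fst).
  exact: (measurableT_comp mg measurable_snd).
have h0 z : 0 <= h z by exact: mule_ge0.
transitivity (\int[pushforward Q (fun w => (X i w, X j w))]_z h z).
  by rewrite (ge0_integral_pushforward mXij).
rewrite (eq_measure_integral (distribution Q Xi \x distribution Q Xj));
  last first.
  move=> A mA _; apply/esym/product_measure_unique => //= C D mC mD.
  exact: independent_pair.
rewrite fubini_tonelli1// /fubini_F /h/=.
under eq_integral do rewrite ge0_integralZl//.
rewrite ge0_integralZr ?integral_ge0//.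
by rewrite (ge0_integral_distribution Xi)// (ge0_integral_distribution Xj).
Qed.

End law.

(** * Mean and variance of a sample mean *)

(** The variance of a function of mean 1 under the probability density [w] is
    its second moment minus 1. *)
Lemma integral_sqr_sub1 d (T : measurableType d) (R : realType)
  (mu : {measure set T -> \bar R}) (a w : T -> R)
  (m : R) :
  measurable_fun [set: T] a -> (forall x, (0 <= a x)%R) ->
  measurable_fun [set: T] w -> (forall x, (0 <= w x)%R) ->
  (\int[mu]_x (w x)%:E = 1 -> \int[mu]_x (a x * w x)%:E = 1 ->
  \int[mu]_x (a x ^+ 2 * w x)%:E = m%:E ->
  \int[mu]_x ((a x - 1) ^+ 2 * w x)%:E = (m - 1)%:E)%E.
Proof.
move=> ma a0 mw w0 w1 aw1 aw2.
have : (\int[mu]_x ((a x - 1) ^+ 2 * w x)%:E + 2%:E = m%:E + 1)%E.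
  rewrite -[2%:E]mule1 -{1}aw1 -aw2 -w1 -ge0_integralZl//; last 2 first.
  - by apply/measurable_EFinP; exact: measurable_funM.
  - by move=> x _; rewrite lee_fin mulr_ge0.
  rewrite -!ge0_integralD//.
  - by apply: eq_integral => x _; rewrite -EFinM -!EFinD; congr EFin; ring.
  - by move=> x _; rewrite lee_fin mulr_ge0// sqr_ge0.
  - apply/measurable_EFinP; apply: measurable_funM => //.
    exact: measurable_funX.
  - by move=> x _; rewrite lee_fin.
  - exact/measurable_EFinP.
  - by move=> x _; rewrite lee_fin mulr_ge0// sqr_ge0.
  - apply/measurable_EFinP; apply: measurable_funM => //.
    by apply: measurable_funX; exact: measurable_funB.
  - by move=> x _; rewrite -EFinM lee_fin !mulr_ge0.
  - apply/measurable_EFinP; apply: measurable_funM => //.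
    exact: measurable_funM.
case: (\int[mu]_x _)%E => [v| |]//.
by rewrite -!EFinD => -[vm]; congr EFin; rewrite -(addrK 2 v)%R vm; ring.
Qed.

Section sample_mean.
Local Open Scope ereal_scope.
Context d (T : measurableType d) (R : realType).
Variables (Q : probability T R) (n N : nat) (X : 'I_N -> T -> 'cV[R]_n).
Variables (p h : 'cV[R]_n -> R).
Hypotheses (N0 : (0 < N)%N).
Hypotheses (mX : forall i, measurable_fun [set: T] (X i)).
Hypotheses (X_iid : iid_pdf Q X p) (p_pdf : is_pdf p).
Hypotheses (mh : measurable_fun [set: 'cV[R]_n] h) (h0 : forall z, (0 <= h z)%R).
Hypothesis h1 : \int[lebesgue_cV n]_z (h z * p z)%:E = 1.

Let S w : R := (N%:R^-1 * \sum_(i < N) h (X i w))%R.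

Let mhX i : measurable_fun [set: T] (fun w => h (X i w)).
Proof. exact: (measurableT_comp mh (mX i)). Qed.

Let int_hX i : \int[Q]_w (h (X i w))%:E = 1.
Proof.
have [mp p0 _] := p_pdf.
rewrite (has_pdf_integral (g := EFin \o h) (mX i) (X_iid.2 i))//.
exact/measurable_EFinP.
Qed.

Lemma sample_mean_integral :
  \int[Q]_w (N%:R^-1 * \sum_(i < N) h (X i w))%:E = 1.
Proof.
under eq_integral do rewrite EFinM -sumEFin.
have mEhX i : measurable_fun [set: T] (fun w => (h (X i w))%:E).
  exact/measurable_EFinP.
rewrite ge0_integralZl ?lee_fin ?exprn_ge0 ?invr_ge0//; last 2 first.
- exact: emeasurable_sum.
- by move=> w _; apply: sume_ge0 => i _; rewrite lee_fin.
rewrite ge0_integral_sum//; last by move=> i w _; rewrite lee_fin.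
under eq_bigr do rewrite int_hX.
rewrite sumEFin sumr_const card_ord -EFinM; congr EFin.
by rewrite mulVf// pnatr_eq0 -lt0n.
Qed.

(* finiteness of the second moment *)
Variable m2 : R.
Hypothesis h2 : \int[lebesgue_cV n]_z (h z ^+ 2 * p z)%:E = m2%:E.

Let int_hXhX i j : \int[Q]_w (h (X i w) * h (X j w))%:E =
  (1 + (i == j)%:R * (m2 - 1))%:E.
Proof.
have [mp p0 _] := p_pdf; have mEh := (measurable_EFinP _ _).2 mh.
have [<-|ij] := eqVneq i j.
  rewrite mul1r addrC subrK -h2.
  rewrite (has_pdf_integral (g := fun z => (h z * h z)%:E) (mX i) (X_iid.2 i))//.
  - by apply/measurable_EFinP; exact: measurable_funM.
  - by move=> z; rewrite lee_fin mulr_ge0.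
rewrite mul0r addr0; under eq_integral do rewrite EFinM.
rewrite (independent_integralM (f := EFin \o h) (g := EFin \o h) mX X_iid.1)//.
by rewrite !int_hX mule1.
Qed.

Let int_S2 : \int[Q]_w (S w ^+ 2)%:E = (1 + (m2 - 1) / N%:R)%:E.
Proof.
have N_neq0 : N%:R != 0%R :> R by rewrite pnatr_eq0 -lt0n.
have m1 i j : measurable_fun [set: T] (fun w => (h (X i w) * h (X j w))%:E).
  by apply/measurable_EFinP; exact: measurable_funM.
have SE w : (S w ^+ 2)%:E = ((N%:R^-1) ^+ 2)%:E *
    \sum_(i < N) \sum_(j < N) (h (X i w) * h (X j w))%:E.
  under eq_bigr do rewrite sumEFin.
  rewrite sumEFin -EFinM /S exprMn; congr (_ * _)%:E.
  rewrite expr2 mulr_suml; apply: eq_bigr => i _.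
  by rewrite mulr_sumr.
under eq_integral do rewrite SE.
have m3 i : measurable_fun [set: T]
    (fun w => \sum_(j < N) (h (X i w) * h (X j w))%:E).
  exact: emeasurable_sum.
have p3 i w : 0 <= \sum_(j < N) (h (X i w) * h (X j w))%:E.
  by apply: sume_ge0 => j _; rewrite lee_fin mulr_ge0.
rewrite ge0_integralZl ?lee_fin ?exprn_ge0 ?invr_ge0//; last 2 first.
- exact: emeasurable_sum.
- by move=> w _; exact: sume_ge0.
rewrite ge0_integral_sum//.
under eq_bigr => i _.
  rewrite ge0_integral_sum//; last by move=> j w _; rewrite lee_fin mulr_ge0.
  under eq_bigr do rewrite int_hXhX.
  rewrite sumEFin big_split/= sumr_const card_ord -mulr_suml.
  rewrite (bigD1 i)//= eqxx big1 ?addr0 ?mul1r; last first.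
    by move=> j ji; rewrite eq_sym (negbTE ji).
  over.
rewrite sumEFin sumr_const card_ord -EFinM; congr EFin.
by rewrite -mulr_natl; field.
Qed.

(** Only the diagonal terms of the expanded square contribute, by pairwise
    independence. *)
Lemma sample_mean_variance :
  \int[Q]_w ((N%:R^-1 * \sum_(i < N) h (X i w) - 1) ^+ 2)%:E =
  (N%:R^-1)%:E * pdf_variance p h.
Proof.
under eq_integral do rewrite -/(S _).
have [mp p0 p1] := p_pdf.
have -> : pdf_variance p h = (m2 - 1)%:E.
  rewrite /pdf_variance {2}/pdf_expectation.
  rewrite (_ : \int[_]_x _ = 1); last by rewrite -h1.
  rewrite -(integral_sqr_sub1 mh h0 mp p0 p1 h1 h2).
  by apply: eq_integral => z _.
have mS : measurable_fun [set: T] S.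
  by apply: measurable_funM => //; exact: measurable_sum.
have S0 w : (0 <= S w)%R by rewrite mulr_ge0 ?invr_ge0// sumr_ge0.
under eq_integral do rewrite -[((_ - 1) ^+ 2)%R]mulr1.
rewrite (integral_sqr_sub1 (m := 1 + (m2 - 1) / N%:R) mS S0)//.
- by rewrite -EFinM addrAC subrr add0r mulrC.
- by rewrite integral_cst// mul1e; exact: probability_setT.
- under eq_integral do rewrite mulr1; exact: sample_mean_integral.
- under eq_integral do rewrite mulr1; exact: int_S2.
Qed.

End sample_mean.

(** * Disintegration of the prior *)

Section rectangles.
Local Open Scope ereal_scope.
Context d1 d2 (T1 : measurableType d1) (T2 : measurableType d2) (R : realType).

(** Two finite laws on a product that agree on rectangles give the same
    expectations. *)
Lemma ge0_integral_eq_rectangles d d' (X : measurableType d)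
  (X' : measurableType d') (mu : {measure set X -> \bar R})
  (mu' : {measure set X' -> \bar R}) (phi : X -> T1 * T2)
  (phi' : X' -> T1 * T2) (f : T1 * T2 -> \bar R) :
  measurable_fun [set: X] phi -> measurable_fun [set: X'] phi' ->
  mu [set: X] < +oo ->
  (forall A B, measurable A -> measurable B ->
     mu (phi @^-1` (A `*` B)) = mu' (phi' @^-1` (A `*` B))) ->
  measurable_fun [set: T1 * T2] f -> (forall z, 0 <= f z) ->
  \int[mu]_x f (phi x) = \int[mu']_x f (phi' x).
Proof.
move=> mphi mphi' muoo muE mf f0.
rewrite -[LHS](ge0_integral_pushforward mphi mu measurableT mf)//.
rewrite -[RHS](ge0_integral_pushforward mphi' mu' measurableT mf)//.
apply: eq_measure_integral => C mC _.
pose rect : set (set (T1 * T2)) :=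
  [set A `*` B | A in measurable & B in measurable].
apply: (measure_unique rect (fun=> setT)) => //.
- by rewrite measurable_prod_measurableType.
- move=> _ _ [A1 mA1 [A2 mA2 <-]] [B1 mB1 [B2 mB2 <-]].
  rewrite -setXI; exists (A1 `&` B1); first exact: measurableI.
  by exists (A2 `&` B2) => //; exact: measurableI.
- by move=> _; exists setT => //; exists setT => //; rewrite setXTT.
- by rewrite bigcup_const.
- by move=> _ [A mA [B mB <-]]; exact: muE.
Qed.

End rectangles.

Section linear_maps.
Context {R : realType}.

Lemma measurable_mulmx d (T : measurableType d) n k (A : 'M[R]_(k, n))
  (f : T -> 'cV[R]_n) :
  measurable_fun [set: T] f -> measurable_fun [set: T] (fun t => A *m f t).
Proof.
move=> mf; apply: measurable_cVP => i; under eq_fun do rewrite mxE.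
apply: measurable_sum => j; apply: measurable_funM => //.
exact: (measurableT_comp (measurable_coord j) mf).
Qed.

Lemma measurable_addmx d (T : measurableType d) n (f g : T -> 'cV[R]_n) :
  measurable_fun [set: T] f -> measurable_fun [set: T] g ->
  measurable_fun [set: T] (fun t => f t + g t).
Proof.
move=> mf mg; apply: measurable_cVP => i; under eq_fun do rewrite mxE.
apply: measurable_funD; first exact: (measurableT_comp (measurable_coord i) mf).
exact: (measurableT_comp (measurable_coord i) mg).
Qed.

Lemma measurable_coords n k (V : 'M[R]_(n, k)) (A : 'M[R]_n) :
  measurable_fun [set: 'cV[R]_n] (fun x => coords V (A *m x)).
Proof.
rewrite /coords.
under eq_fun do rewrite trmx_mul trmxK; apply: measurable_mulmx.
by apply: measurable_mulmx; exact: measurable_id.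
Qed.

End linear_maps.

Section disintegration.
Context {R : realType} (n r s : nat) (Pi : 'M[R]_n).
Variables (V_r : 'M[R]_(n, r)) (V_perp : 'M[R]_(n, s)).
Variables (prior : 'cV[R]_n -> R) (cond_pdf : 'cV[R]_r -> 'cV[R]_s -> R).
Hypotheses (prior_pdf : is_pdf prior)
  (hcond : is_conditional_pdf Pi V_r V_perp prior cond_pdf).

Local Notation z_r := (coord_r Pi V_r).
Local Notation z_perp := (coord_perp Pi V_perp).

(** The defining property of a conditional density, stated for rectangles,
    extends to nonnegative functions of both coordinates. *)
Lemma conditional_pdf_integral (f : 'cV[R]_r * 'cV[R]_s -> \bar R) :
  measurable_fun [set: 'cV[R]_r * 'cV[R]_s] f -> (forall z, 0 <= f z)%E ->
  (\int[lebesgue_cV n]_x (f (z_r x, z_perp x) * (prior x)%:E) =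
   \int[lebesgue_cV n]_x
     ((\int[lebesgue_cV s]_z (f (z_r x, z) * (cond_pdf (z_r x) z)%:E)) *
      (prior x)%:E))%E.
Proof.
move=> mf f0; have [mc c_pdf condE] := hcond; have [mp p0 p1] := prior_pdf.
have mzr : measurable_fun [set: 'cV[R]_n] z_r by exact: measurable_coords.
have mzp : measurable_fun [set: 'cV[R]_n] z_perp by exact: measurable_coords.
pose phi x := (z_r x, z_perp x).
have mphi : measurable_fun [set: 'cV[R]_n] phi by exact: measurable_fun_pair.
pose phi' (y : 'cV[R]_n * 'cV[R]_s) := (z_r y.1, y.2).
have mphi' : measurable_fun [set: 'cV[R]_n * 'cV[R]_s] phi'.
  apply: measurable_fun_pair => //.
  exact: (measurableT_comp mzr measurable_fst).
pose w (y : 'cV[R]_n * 'cV[R]_s) := cond_pdf (z_r y.1) y.2 * prior y.1.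
have mw : measurable_fun [set: 'cV[R]_n * 'cV[R]_s] w.
  apply: measurable_funM; first exact: (measurableT_comp mc mphi').
  exact: (measurableT_comp mp measurable_fst).
have w0 y : 0 <= w y by rewrite mulr_ge0//; have [_ ->] := c_pdf (z_r y.1).
pose mu := density_measure (lebesgue_cV n) mp p0.
pose mu' := density_measure (lebesgue_cV n \x lebesgue_cV s)%E mw w0.
have mcx x : measurable_fun [set: 'cV[R]_s] (fun z => cond_pdf (z_r x) z).
  by have [] := c_pdf (z_r x).
have cx0 x z : 0 <= cond_pdf (z_r x) z by have [_ ->] := c_pdf (z_r x).
(* for a nonnegative g, the double integral of g (z_r x) z against
   cond_pdf (z_r x) z * prior x is an integral against mu' *)
have iterE (g : 'cV[R]_r * 'cV[R]_s -> \bar R) :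
    measurable_fun [set: 'cV[R]_r * 'cV[R]_s] g -> (forall z, 0 <= g z)%E ->
    (\int[lebesgue_cV n]_x
     ((\int[lebesgue_cV s]_z (g (z_r x, z) * (cond_pdf (z_r x) z)%:E)) *
      (prior x)%:E) = \int[mu']_y g (phi' y))%E.
  move=> mg g0; have mgphi := measurableT_comp mg mphi'.
  rewrite (ge0_integral_density_measure _ mw w0 mgphi) => [|y]; last exact: g0.
  rewrite fubini_tonelli1/=.
  - apply: eq_integral => x _; rewrite /fubini_F -ge0_integralZr//.
    + by apply: eq_integral => z _; rewrite EFinM muleA.
    + apply: emeasurable_funM; last exact/measurable_EFinP.
      exact: (measurableT_comp mgphi (measurable_pair1 x)).
    + by move=> z _; rewrite mule_ge0// lee_fin.
    + by rewrite lee_fin.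
  - by apply: emeasurable_funM => //; exact/measurable_EFinP.
  - by move=> y; rewrite mule_ge0// lee_fin.
rewrite iterE//.
have mEp : measurable_fun [set: 'cV[R]_n] (fun x => f (phi x)).
  exact: (measurableT_comp mf mphi).
rewrite -(ge0_integral_density_measure _ mp p0 mEp)//.
apply: ge0_integral_eq_rectangles => //.
  by rewrite /mu/= /density_measure p1 ltry.
move=> A B mA mB.
transitivity (\int[lebesgue_cV n]_(x in z_r @^-1` A)
    ((\int[lebesgue_cV s]_(z in B) (cond_pdf (z_r x) z)%:E) *
      (prior x)%:E))%E; first exact: condE.
have mAB : measurable (phi' @^-1` (A `*` B)).
  by rewrite -[X in measurable X]setTI; apply: mphi' => //; exact: measurableX.
transitivity (\int[mu']_y (\1_(A `*` B) (phi' y))%:E)%E; last first.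
  by rewrite [LHS](integral_indic mu' measurableT mAB) setIT.
rewrite -(iterE (fun z => (\1_(A `*` B) z)%:E)).
- rewrite integral_mkcond; apply: eq_integral => x _.
  rewrite patchE; case: ifPn => [|/negP]; rewrite inE/= => xA.
    congr (_ * _)%E; rewrite integral_mkcond; apply: eq_integral => z _.
    rewrite patchE indicE in_setX (mem_set xA)/=.
    by case: (z \in B); rewrite ?mul1e ?mul0e.
  rewrite integral0_eq ?mul0e// => z _.
  by rewrite indicE in_setX (memNset xA) mul0e.
- by apply/measurable_EFinP/measurable_indic; exact: measurableX.
- by move=> z; rewrite lee_fin.
Qed.

End disintegration.

(** * Nonnegative measurable functions *)

Section nonnegative_measurable.
Local Open Scope ereal_scope.
Context d (T : measurableType d) (R : realType).

(** Nonnegative measurable real functions *)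
Definition nnmeasurable (f : T -> R) :=
  measurable_fun [set: T] f /\ forall x, (0 <= f x)%R.

Lemma nnmeasurableD f g :
  nnmeasurable f -> nnmeasurable g -> nnmeasurable (fun x => f x + g x)%R.
Proof.
move=> [mf f0] [mg g0]; split; first exact: measurable_funD.
by move=> x; rewrite addr_ge0.
Qed.

Lemma nnmeasurableM f g :
  nnmeasurable f -> nnmeasurable g -> nnmeasurable (fun x => f x * g x)%R.
Proof.
move=> [mf f0] [mg g0]; split; first exact: measurable_funM.
by move=> x; rewrite mulr_ge0.
Qed.

Lemma nnmeasurableZ (c : R) f :
  (0 <= c)%R -> nnmeasurable f -> nnmeasurable (fun x => c * f x)%R.
Proof. by move=> c0 mf; apply: nnmeasurableM => //; split. Qed.

Lemma nnmeasurable_sqrB1 f :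
  nnmeasurable f -> nnmeasurable (fun x => (f x - 1) ^+ 2)%R.
Proof.
move=> [mf f0]; split; last by move=> x; exact: sqr_ge0.
by apply: measurable_funX; exact: measurable_funB.
Qed.

Lemma nnmeasurable_sqrt f :
  nnmeasurable f -> nnmeasurable (fun x => Num.sqrt (f x)).
Proof.
move=> [mf _]; split; last by move=> x; exact: sqrtr_ge0.
apply: measurableT_comp mf; apply: continuous_measurable_fun.
exact: sqrt_continuous.
Qed.

Lemma nnmeasurableV f :
  nnmeasurable f -> nnmeasurable (fun x => (f x)^-1)%R.
Proof.
move=> [mf f0]; split; last by move=> x; rewrite invr_ge0.
under eq_fun do rewrite -powR_inv1//.
exact: (measurableT_comp (measurable_powR (-1)%R) mf).
Qed.

Variable mu : {measure set T -> \bar R}.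

Lemma nn_integralD f g : nnmeasurable f -> nnmeasurable g ->
  \int[mu]_x (f x + g x)%:E = \int[mu]_x (f x)%:E + \int[mu]_x (g x)%:E.
Proof.
move=> [mf f0] [mg g0]; rewrite -ge0_integralD//.
- by move=> x _; rewrite lee_fin.
- exact/measurable_EFinP.
- by move=> x _; rewrite lee_fin.
- exact/measurable_EFinP.
Qed.

Lemma nn_integralZ c f : (0 <= c)%R -> nnmeasurable f ->
  \int[mu]_x (c * f x)%:E = c%:E * \int[mu]_x (f x)%:E.
Proof.
move=> c0 [mf f0]; rewrite -ge0_integralZl//.
- exact/measurable_EFinP.
- by move=> x _; rewrite lee_fin.
Qed.

Lemma nn_integral_le f g : nnmeasurable f -> nnmeasurable g ->
  (forall x, f x <= g x)%R -> \int[mu]_x (f x)%:E <= \int[mu]_x (g x)%:E.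
Proof.
move=> [mf f0] [mg g0] fg; apply: ge0_le_integral => //.
- by move=> x _; rewrite lee_fin.
- exact/measurable_EFinP.
- exact/measurable_EFinP.
- by move=> x _; rewrite lee_fin.
Qed.

Lemma nn_integral_ge0 f : nnmeasurable f -> 0 <= \int[mu]_x (f x)%:E.
Proof. by move=> [_ f0]; apply: integral_ge0 => x _; rewrite lee_fin. Qed.

End nonnegative_measurable.

Lemma probability_integral_cst d (T : measurableType d) (R : realType)
  (Q : probability T R) (c : R) : (\int[Q]_x c%:E = c%:E)%E.
Proof.
transitivity (c%:E * Q [set: T])%E; first exact: integral_cst.
by rewrite [X in (_ * X)%E](@probability_setT _ _ _ Q) mule1.
Qed.

(** * Hellinger distance to a randomly reweighted density *)

Section hellinger_pointwise.
Context {R : realType}.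

(** The integrand of the Hellinger distance between [p] and [W q / T] to second
    order in [W - 1] and [T - 1]: by convexity [1 / sqrt T >= 1 - (T - 1) / 2],
    and Young's inequality splits the products. *)
Lemma hellinger_reweighted_le (p q W T : R) :
  0 <= p -> 0 <= q -> 0 <= W -> 0 < T ->
  2^-1 * (Num.sqrt p - Num.sqrt (W * q / T)) ^+ 2
    + (Num.sqrt (p * q) + 2^-1 * (Num.sqrt (p * q) * W)) <=
  2^-1 * p + ((2 * T)^-1 * (W * q) + (2^-1 * T * Num.sqrt (p * q)
    + (4^-1 * ((W - 1) ^+ 2 * p) + (2^-1 * ((W - 1) ^+ 2 * q)
    + 4^-1 * (T - 1) ^+ 2 * p)))).
Proof.
move=> p0 q0 W0 T0.
have TV0 : 0 <= T^-1 by rewrite invr_ge0 ltW.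
rewrite !sqrtrM ?mulr_ge0//.
have := sqr_sqrtr p0; have := sqr_sqrtr q0; have := sqr_sqrtr W0.
have := sqr_sqrtr (ltW T0); have := sqrtr_ge0 p; have := sqrtr_ge0 q.
have := sqrtr_ge0 W; have : 0 < Num.sqrt T by rewrite sqrtr_gt0.
rewrite sqrtrV ?(ltW T0)//.
set a := Num.sqrt p; set b := Num.sqrt q; set u := Num.sqrt W.
set t := Num.sqrt T; move=> t0 u0 b0 a0 <- <- <- <- {p0 q0 W0 T0 TV0}.
have tV : (3 - t ^+ 2) / 2 <= t^-1.
  rewrite -(ler_pM2r t0) mulVf ?gt_eqF// -subr_ge0.
  rewrite (_ : _ - _ = (t - 1) ^+ 2 * (t + 2) / 2); last by field.
  by rewrite -mulrA mulr_ge0 ?sqr_ge0 ?mulr_ge0 ?addr_ge0 ?(ltW t0)//.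
have abu0 : 0 <= a * b * u by rewrite !mulr_ge0.
have u1 : (u - 1) ^+ 2 <= (u ^+ 2 - 1) ^+ 2.
  rewrite (_ : u ^+ 2 - 1 = (u - 1) * (u + 1)); last by ring.
  by rewrite exprMn ler_peMr ?sqr_ge0// exprn_ege1// lerDr.
(* the difference as a sum of nonnegative terms *)
rewrite -subr_ge0.
rewrite (_ : _ - _ = a * b * u * (t^-1 - (3 - t ^+ 2) / 2)
    + (4^-1 * a ^+ 2 + 2^-1 * b ^+ 2) * ((u ^+ 2 - 1) ^+ 2 - (u - 1) ^+ 2)
    + 4^-1 * ((a - b) * (u - 1)) ^+ 2
    + 4^-1 * (b * (u - 1) - a * (t ^+ 2 - 1)) ^+ 2); last first.
  by field; rewrite gt_eqF.
have cab : 0 <= 4^-1 * a ^+ 2 + 2^-1 * b ^+ 2.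
  by apply: addr_ge0; rewrite mulr_ge0 ?sqr_ge0.
apply: addr_ge0; last by rewrite mulr_ge0 ?sqr_ge0.
apply: addr_ge0; last by rewrite mulr_ge0 ?sqr_ge0.
by apply: addr_ge0; rewrite mulr_ge0 ?subr_ge0.
Qed.

(** Jensen's inequality for [(T - 1) ^+ 2], before integration against [q] *)
Lemma sqr_mean_sub1_le (q W T : R) : 0 <= q ->
  q + 2 * T * (W * q) <=
  (W - 1) ^+ 2 * q + (T ^+ 2 * q + 2 * (W * q)).
Proof.
move=> q0; rewrite -subr_ge0 (_ : _ - _ = (W - T) ^+ 2 * q); last by ring.
by rewrite mulr_ge0// sqr_ge0.
Qed.

End hellinger_pointwise.

(** Integration of a pathwise bound over the draws: as [K] and [T] have means
    [G] and 1, the terms in [G] combine into [G]. *)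
Lemma expectation_bound d (Omega : measurableType d) (R : realType)
  (Q : probability Omega R) (h K Ip Iq : Omega -> \bar R) (T : Omega -> R)
  (G : R) (V : \bar R) :
  ((forall w, 0 <= h w) -> measurable_fun [set: Omega] h ->
  measurable_fun [set: Omega] K -> (forall w, 0 <= K w) ->
  measurable_fun [set: Omega] Ip -> (forall w, 0 <= Ip w) ->
  measurable_fun [set: Omega] Iq -> (forall w, 0 <= Iq w) ->
  nnmeasurable T -> (0 <= G)%R ->
  \int[Q]_w K w = G%:E -> \int[Q]_w (T w)%:E = 1 ->
  \int[Q]_w Ip w = V -> \int[Q]_w Iq w = V ->
  (forall w, h w + (G%:E + 2^-1%:E * K w) <=
     (1 + 2^-1 * G * T w)%:E + (4^-1%:E * Ip w + (3 / 4)%:E * Iq w)) ->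
  \int[Q]_w h w + G%:E <= 1 + V)%E.
Proof.
move=> h0 mh mK K0 mIp Ip0 mIq Iq0 mT G0 KG T1 IpV IqV h_le.
have G2 : 0 <= 2^-1 * G by rewrite mulr_ge0.
have m1T : nnmeasurable (fun w => 1 + 2^-1 * G * T w).
  apply: nnmeasurableD (nnmeasurableZ G2 mT).
  by split.
have K20 w : (0 <= G%:E + 2^-1%:E * K w)%E.
  by rewrite adde_ge0 ?mule_ge0 ?lee_fin.
have mGK : measurable_fun [set: Omega] (fun w => G%:E + 2^-1%:E * K w)%E.
  by apply: emeasurable_funD => //; exact: measurable_funeM.
have I0 w : (0 <= 4^-1%:E * Ip w + (3 / 4)%:E * Iq w)%E.
  by rewrite adde_ge0 ?mule_ge0 ?lee_fin.
have mI : measurable_fun [set: Omega]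
    (fun w => 4^-1%:E * Ip w + (3 / 4)%:E * Iq w)%E.
  by apply: emeasurable_funD; exact: measurable_funeM.
have m1T' : measurable_fun [set: Omega] (fun w => (1 + 2^-1 * G * T w)%:E).
  by apply/measurable_EFinP; case: m1T.
have : (\int[Q]_w (h w + (G%:E + 2^-1%:E * K w)) <= \int[Q]_w
    ((1 + 2^-1 * G * T w)%:E + (4^-1%:E * Ip w + (3 / 4)%:E * Iq w)))%E.
  apply: ge0_le_integral => //; try exact: emeasurable_funD.
  by move=> w _; exact: adde_ge0.
rewrite !ge0_integralD//; try exact: measurable_funeM;
  try (by move=> w _; rewrite ?mule_ge0 ?lee_fin//; case: m1T).
rewrite !ge0_integralZl// ?lee_fin//.
rewrite KG IpV IqV probability_integral_cst.
rewrite (nn_integralD _ (_ : nnmeasurable (fun=> 1)) (nnmeasurableZ G2 mT));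
  last by split.
rewrite (nn_integralZ _ G2 mT) T1 mule1 probability_integral_cst.
have : (0 <= V)%E by rewrite -IpV; exact: integral_ge0.
have : (0 <= \int[Q]_w h w)%E by exact: integral_ge0.
case: (\int[Q]_w h w)%E => [e| |]//; case: V {IpV IqV} => [V| |]//.
  by rewrite -?EFinM -!EFinD !lee_fin; lra.
by move=> _ _ _; rewrite addey// leey.
Qed.

Section expected_hellinger.
Local Open Scope ereal_scope.
Context d1 d2 (Omega : measurableType d1) (X : measurableType d2) (R : realType).
Variables (Q : probability Omega R) (mu : {sigma_finite_measure set X -> \bar R}).
(* [q] is reweighted by the random function [W], of mean 1 at every point, and
   [T] normalizes [W q]. *)
Variables (p q : X -> R) (W : Omega -> X -> R) (T : Omega -> R) (G : R).
Hypotheses (mp : nnmeasurable p) (mq : nnmeasurable q).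
Hypothesis mW : nnmeasurable (fun y : Omega * X => W y.1 y.2).
Hypotheses (p1 : \int[mu]_x (p x)%:E = 1) (q1 : \int[mu]_x (q x)%:E = 1).
Hypothesis GE : \int[mu]_x (Num.sqrt (p x * q x))%:E = G%:E.
Hypothesis W1 : forall x, \int[Q]_w (W w x)%:E = 1.
Hypothesis T0 : forall w, (0 < T w)%R.
Hypothesis TE : forall w, \int[mu]_x (W w x * q x)%:E = (T w)%:E.

(* The pointwise variance of [W] has the same mean under [p] and [q]. *)
Hypothesis pvE :
  \int[mu]_x ((\int[Q]_w ((W w x - 1) ^+ 2)%:E) * (p x)%:E) =
  \int[mu]_x ((\int[Q]_w ((W w x - 1) ^+ 2)%:E) * (q x)%:E).

Let v x := \int[Q]_w ((W w x - 1) ^+ 2)%:E.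
Let V := \int[mu]_x (v x * (q x)%:E).

Let alpha x := Num.sqrt (p x * q x).

Let malpha : nnmeasurable alpha.
Proof. exact/nnmeasurable_sqrt/nnmeasurableM. Qed.

Let mWw w : nnmeasurable (W w).
Proof.
split; last by move=> x; exact: mW.2 (w, x).
exact: (measurableT_comp mW.1 (measurable_pair1 w)).
Qed.

Let mWx x : nnmeasurable (W ^~ x).
Proof.
split; last by move=> w; exact: mW.2 (w, x).
exact: (measurableT_comp mW.1 (measurable_pair2 x)).
Qed.

Let m_snd (f : X -> R) :
  nnmeasurable f -> nnmeasurable (fun y : Omega * X => f y.2).
Proof.
move=> [mf f0]; split => //; exact: (measurableT_comp mf measurable_snd).
Qed.

Let G0 : (0 <= G)%R.
Proof. by rewrite -lee_fin -GE; exact: nn_integral_ge0. Qed.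

Let measurable_int1 (f : Omega * X -> R) : nnmeasurable f ->
  measurable_fun [set: Omega] (fun w => \int[mu]_x (f (w, x))%:E).
Proof.
move=> [mf f0].
apply: (measurable_fun_fubini_tonelli_F (fun y => (f y)%:E)).
  exact/measurable_EFinP.
by move=> y; rewrite lee_fin.
Qed.

Let fubini_nn (f : Omega * X -> R) : nnmeasurable f ->
  \int[Q]_w \int[mu]_x (f (w, x))%:E = \int[mu]_x \int[Q]_w (f (w, x))%:E.
Proof.
move=> [mf f0].
apply: (fubini_tonelli (fun y => (f y)%:E)); first exact/measurable_EFinP.
by move=> y; rewrite lee_fin.
Qed.

Let measurable_T : measurable_fun [set: Omega] T.
Proof.
apply/measurable_EFinP.
rewrite [X in measurable_fun _ X](_ : _ =
    (fun w => \int[mu]_x (W w x * q x)%:E)); last first.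
  by apply/funext => w /=; rewrite TE.
apply: (measurable_int1 (f := fun y => W y.1 y.2 * q y.2)%R).
by apply: nnmeasurableM => //; exact: m_snd.
Qed.

Let int_WM (f : X -> R) : nnmeasurable f ->
  \int[Q]_w \int[mu]_x (f x * W w x)%:E = \int[mu]_x (f x)%:E.
Proof.
move=> mf; rewrite (fubini_nn (f := fun y => f y.2 * W y.1 y.2)%R)/=; last first.
  by apply: nnmeasurableM => //; exact: m_snd.
apply: eq_integral => x _; rewrite (nn_integralZ _ (mf.2 x) (mWx x)).
by rewrite W1 mule1.
Qed.

Let int_T : \int[Q]_w (T w)%:E = 1.
Proof.
under eq_integral do rewrite -TE.
under eq_integral do under eq_integral do rewrite mulrC.
by rewrite int_WM.
Qed.

Let I (f : X -> R) w := \int[mu]_x ((W w x - 1) ^+ 2 * f x)%:E.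

Let mI (f : X -> R) : nnmeasurable f ->
  nnmeasurable (fun y : Omega * X => (W y.1 y.2 - 1) ^+ 2 * f y.2)%R.
Proof.
by move=> mf; apply: nnmeasurableM; [exact: nnmeasurable_sqrB1|exact: m_snd].
Qed.

Let int_I (f : X -> R) : nnmeasurable f ->
  \int[Q]_w I f w = \int[mu]_x (v x * (f x)%:E).
Proof.
move=> mf; rewrite /I (fubini_nn (mI mf)); apply: eq_integral => x _ /=.
rewrite muleC -(nn_integralZ _ (mf.2 x)); last exact: nnmeasurable_sqrB1.
by under eq_integral do rewrite mulrC.
Qed.

Let T_sub1_sqr w : ((T w - 1) ^+ 2)%:E <= I q w.
Proof.
have mIq : nnmeasurable (fun x => (W w x - 1) ^+ 2 * q x)%R.
  by apply: nnmeasurableM => //; exact: nnmeasurable_sqrB1.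
have mWq := nnmeasurableM (mWw w) mq.
have mTq : nnmeasurable (fun x => T w ^+ 2 * q x)%R.
  by apply: nnmeasurableZ => //; exact: sqr_ge0.
have m2Wq : nnmeasurable (fun x => 2 * (W w x * q x))%R.
  exact: nnmeasurableZ.
have T2 : (0 <= 2 * T w)%R by rewrite mulr_ge0// ltW.
have m2TWq := nnmeasurableZ T2 mWq.
have := nn_integral_le mu (nnmeasurableD mq m2TWq)
  (nnmeasurableD mIq (nnmeasurableD mTq m2Wq))
  (fun x => sqr_mean_sub1_le (W w x) (T w) (mq.2 x)).
rewrite !nn_integralD//; last exact: nnmeasurableD.
rewrite !nn_integralZ ?sqr_ge0// TE q1 -/(I q w).
case: (I q w) => [i| |]; rewrite ?leey//.
by rewrite -?EFinM -?EFinD !lee_fin; lra.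
Qed.

Let h w :=
  \int[mu]_x (2^-1 * (Num.sqrt (p x) - Num.sqrt (W w x * q x / T w)) ^+ 2)%:E.

Let mh : nnmeasurable (fun y : Omega * X =>
  2^-1 * (Num.sqrt (p y.2) - Num.sqrt (W y.1 y.2 * q y.2 / T y.1)) ^+ 2)%R.
Proof.
apply: nnmeasurableZ => //; split; last by move=> y; exact: sqr_ge0.
apply: measurable_funX; apply: measurable_funB.
  by have [] := m_snd (nnmeasurable_sqrt mp).
have mT : nnmeasurable (fun y : Omega * X => T y.1).
  split; last by move=> y; exact: ltW.
  exact: (measurableT_comp measurable_T measurable_fst).
have [//] := nnmeasurable_sqrt (nnmeasurableM (nnmeasurableM mW (m_snd mq))
  (nnmeasurableV mT)).
Qed.

Let h_le w :
  h w + (G%:E + 2^-1%:E * \int[mu]_x (alpha x * W w x)%:E) <=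
  (1 + 2^-1 * G * T w)%:E + (4^-1%:E * I p w + (3 / 4)%:E * I q w).
Proof.
have TwV : (0 <= (2 * T w)^-1)%R by rewrite invr_ge0 mulr_ge0// ltW.
have Tw2 : (0 <= 2^-1 * T w)%R by rewrite mulr_ge0// ltW.
have mW2 := nnmeasurable_sqrB1 (mWw w).
have mhw : nnmeasurable (fun x =>
    2^-1 * (Num.sqrt (p x) - Num.sqrt (W w x * q x / T w)) ^+ 2)%R.
  split; last by move=> x; exact: mh.2 (w, x).
  exact: (measurableT_comp mh.1 (measurable_pair1 w)).
have maW := nnmeasurableM malpha (mWw w).
have half0 : (0 <= 2^-1 :> R)%R by [].
have quarter0 : (0 <= 4^-1 :> R)%R by [].
have T1 : (0 <= 4^-1 * (T w - 1) ^+ 2)%R by rewrite mulr_ge0// sqr_ge0.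
have mf1 := nnmeasurableZ half0 maW.
have mf2 := nnmeasurableD malpha mf1.
have mg1 := nnmeasurableZ half0 mp.
have mg2 := nnmeasurableZ TwV (nnmeasurableM (mWw w) mq).
have mg3 := nnmeasurableZ Tw2 malpha.
have mg4 := nnmeasurableZ quarter0 (nnmeasurableM mW2 mp).
have mg5 := nnmeasurableZ half0 (nnmeasurableM mW2 mq).
have mg6 := nnmeasurableZ T1 mp.
have mg56 := nnmeasurableD mg5 mg6.
have mg46 := nnmeasurableD mg4 mg56.
have mg36 := nnmeasurableD mg3 mg46.
have mg26 := nnmeasurableD mg2 mg36.
have := nn_integral_le mu (nnmeasurableD mhw mf2) (nnmeasurableD mg1 mg26)
  (fun x => hellinger_reweighted_le (mp.2 x) (mq.2 x) ((mWw w).2 x) (T0 w)).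
rewrite (nn_integralD _ mhw mf2) (nn_integralD _ malpha mf1).
rewrite (nn_integralD _ mg1 mg26) (nn_integralD _ mg2 mg36).
rewrite (nn_integralD _ mg3 mg46) (nn_integralD _ mg4 mg56).
rewrite (nn_integralD _ mg5 mg6).
rewrite (nn_integralZ _ half0 maW) (nn_integralZ _ half0 mp).
rewrite (nn_integralZ _ TwV (nnmeasurableM (mWw w) mq)).
rewrite (nn_integralZ _ Tw2 malpha).
rewrite (nn_integralZ _ quarter0 (nnmeasurableM mW2 mp)).
rewrite (nn_integralZ _ half0 (nnmeasurableM mW2 mq)).
rewrite (nn_integralZ _ T1 mp) p1 TE GE -/(I p w) -/(I q w) -/(h w).
move=> /le_trans; apply.
have Iq0 : 0 <= I q w by exact: nn_integral_ge0 (nnmeasurableM mW2 mq).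
(* a quarter of [I q w] bounds the term in [(T w - 1) ^+ 2] *)
have -> : (3 / 4)%:E * I q w = 2^-1%:E * I q w + 4^-1%:E * I q w.
  by rewrite -ge0_muleDl// -EFinD; congr (_%:E * _); field.
rewrite !mule1 addeA addeA -!EFinM -!EFinD; apply: leeD.
  by rewrite lee_fin le_eqVlt; apply/orP; left; apply/eqP; field; rewrite gt_eqF.
apply: leeD2l; apply: leeD2l.
by rewrite EFinM lee_wpmul2l ?lee_fin// T_sub1_sqr.
Qed.

(** The expected squared Hellinger distance of [p] and [W q / T] exceeds that
    of [p] and [q], which is [1 - G], by at most the mean variance of [W]. *)
Lemma expected_hellinger_reweighted :
  \int[Q]_w \int[mu]_x
     (2^-1 * (Num.sqrt (p x) - Num.sqrt (W w x * q x / T w)) ^+ 2)%:E + G%:E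
  <= 1 + \int[mu]_x ((\int[Q]_w ((W w x - 1) ^+ 2)%:E) * (q x)%:E).
Proof.
have I0 f w : nnmeasurable f -> 0 <= I f w.
  move=> mf; apply: integral_ge0 => x _; rewrite lee_fin.
  exact: (mI mf).2 (w, x).
have mT : nnmeasurable T by split; [exact: measurable_T | move=> w; exact: ltW].
have IpV : \int[Q]_w I p w = V by rewrite int_I.
rewrite -/V.
apply: (expectation_bound _ _ (measurable_int1 (nnmeasurableM (m_snd malpha) mW))
  _ (measurable_int1 (mI mp)) (fun w => I0 p w mp) (measurable_int1 (mI mq))
  (fun w => I0 q w mq) mT G0 (etrans (int_WM malpha) GE) int_T IpV (int_I mq)
  h_le).
- by move=> w; apply: integral_ge0 => x _; rewrite lee_fin; exact: mh.2 (w, x).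
- exact: measurable_int1 mh.
- move=> w; exact: nn_integral_ge0 (nnmeasurableM malpha (mWw w)).
Qed.

End expected_hellinger.

(** * The likelihood *)

Section likelihood.
Context {R : realType} (n m : nat).
Variables (F : 'cV[R]_n -> 'cV[R]_m) (C : 'M[R]_m) (Y : 'cV[R]_m).
Hypothesis hC : symmetric_posdef C.

Lemma symmetric_posdef_det : \det C != 0.
Proof.
apply/negP => /det0P[v v0 vC]; have := hC.2 v^T.
by rewrite trmx_eq0 trmxK vC mul0mx mxE ltxx => /(_ v0).
Qed.

Lemma symmetric_posdef_inv_ge0 (y : 'cV[R]_m) :
  0 <= (y^T *m invmx C *m y) ord0 ord0.
Proof.
have uC : C \in unitmx by rewrite unitmxE unitfE symmetric_posdef_det.
have -> : y^T *m invmx C *m y = (invmx C *m y)^T *m C *m (invmx C *m y).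
  by rewrite trmx_mul trmx_inv hC.1 mulmxA mulmxKV// mulmxA.
have [->|u0] := eqVneq (invmx C *m y) 0; first by rewrite mulmx0 mxE.
exact/ltW/hC.2.
Qed.

Lemma likelihood_gt0 x : 0 < likelihood F C Y x.
Proof.
rewrite !mulr_gt0 ?expR_gt0//; first by rewrite powR_gt0 ?mulr_gt0 ?pi_gt0.
by rewrite /powR (negbTE symmetric_posdef_det) expR_gt0.
Qed.

Lemma likelihood_bounded : exists K, forall x, likelihood F C Y x <= K.
Proof.
exists ((2 * pi) `^ (- (m%:R / 2)) * (\det C) `^ (- 2^-1)) => x.
rewrite ler_piMr ?mulr_ge0 ?powR_ge0// -expR0 ler_expR.
by rewrite mulNr oppr_le0 mulr_ge0// symmetric_posdef_inv_ge0.
Qed.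

Lemma measurable_likelihood : measurable_fun [set: 'cV[R]_n] F ->
  measurable_fun [set: 'cV[R]_n] (likelihood F C Y).
Proof.
move=> mF; apply: measurable_funM; first exact: measurable_cst.
apply: measurableT_comp; first exact: measurable_expR.
apply: measurable_funM; first exact: measurable_cst.
have mFY : measurable_fun [set: 'cV[R]_n] (fun x => F x - Y).
  by apply: measurable_addmx.
under eq_fun do rewrite -mulmxA mxE.
apply: measurable_sum => i; under eq_fun do rewrite mxE.
apply: measurable_funM; first exact: (measurableT_comp (measurable_coord i) mFY).
exact: (measurableT_comp (measurable_coord i) (measurable_mulmx _ mFY)).
Qed.

End likelihood.

(** * Coordinates along the image and the kernel of the projector *)

Section decomposition.
Context {R : realType} (n r s : nat) (Pi : 'M[R]_n).
Variables (V_r : 'M[R]_(n, r)) (V_perp : 'M[R]_(n, s)).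
Hypotheses (PiPi : Pi *m Pi = Pi) (hV_r : basis_of_image V_r Pi)
  (hV_perp : basis_of_kernel V_perp Pi).

Lemma coord_decomposition x :
  V_r *m coord_r Pi V_r x + V_perp *m coord_perp Pi V_perp x = x.
Proof. by rewrite coord_rE// coord_perpE// -mulmxDl addrC subrK mul1mx. Qed.

Lemma coord_rK zr z : coord_r Pi V_r (V_r *m zr + V_perp *m z) = zr.
Proof.
have /andP[free_r /eqmxP imV] := hV_r; have /andP[_ /eqmxP kerV] := hV_perp.
have PiV_r : Pi *m V_r = V_r.
  have /submxP[D VD] : (V_r^T <= Pi^T)%MS by rewrite imV.
  apply: trmx_inj; rewrite trmx_mul VD -mulmxA -trmx_mul; congr (_ *m _^T).
  exact: PiPi.
have PiV_perp : Pi *m V_perp = 0.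
  apply: trmx_inj; rewrite trmx_mul trmx0; apply/sub_kermxP.
  by rewrite -kerV.
have -> : coord_r Pi V_r (V_r *m zr + V_perp *m z) = coords V_r (V_r *m zr).
  by rewrite /coord_r mulmxDr !mulmxA PiV_r PiV_perp mul0mx addr0.
by apply: trmx_inj; rewrite trmxK trmx_mul mulmxKp.
Qed.

End decomposition.

(** * Means of bounded positive functions *)

Section pdf.
Context {R : realType} (n : nat) (p : 'cV[R]_n -> R).
Hypothesis p_pdf : is_pdf p.

(** The first component says that the real-valued integral is not a default
    value. *)
Lemma pdf_mean_gt0 (f : 'cV[R]_n -> R) (K : R) :
  measurable_fun [set: 'cV[R]_n] f -> (forall x, 0 < f x <= K) ->
  (\int[lebesgue_cV n]_x (f x * p x)%:E =
     (\int[lebesgue_cV n]_x (f x * p x))%R%:E)%E /\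
  0 < \int[lebesgue_cV n]_x (f x * p x).
Proof.
move=> mf fK; have [mp p0 p1] := p_pdf.
have mfp : nnmeasurable (fun x => f x * p x).
  by apply: nnmeasurableM; split => // x; case/andP: (fK x) => /ltW.
have K0 : 0 <= K by case/andP: (fK 0) => /ltW/le_trans; exact.
have int_le : (\int[lebesgue_cV n]_x (f x * p x)%:E <= K%:E)%E.
  rewrite -[K%:E]mule1 -p1 -nn_integralZ//.
  apply: nn_integral_le => //; first exact: nnmeasurableZ.
  by move=> x; rewrite ler_wpM2r//; case/andP: (fK x).
have int_fin : (\int[lebesgue_cV n]_x (f x * p x)%:E)%E \is a fin_num.
  by rewrite ge0_fin_numE ?(le_lt_trans int_le) ?ltry//; exact: nn_integral_ge0.
split; first by rewrite /Rintegral fineK.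
rewrite fine_gt0// -ge0_fin_numE ?int_fin ?andbT; last exact: nn_integral_ge0.
rewrite lt0e nn_integral_ge0// andbT; apply/eqP => fp0.
suff : (\int[lebesgue_cV n]_x (p x)%:E = 0)%E.
  by rewrite p1 => -[/eqP]; rewrite oner_eq0.
have mEfp := (measurable_EFinP _ _).2 mfp.1.
have /ae_eq_integral_abs : (\int[lebesgue_cV n]_x `|(f x * p x)%:E| = 0)%E.
  rewrite -fp0; apply: eq_integral => x _.
  by rewrite gee0_abs// lee_fin; exact: mfp.2.
move=> /(_ measurableT mEfp) fp_ae.
rewrite (ae_eq_integral (cst 0%E))//; first exact: integral0.
- exact/measurable_EFinP.
- apply: filterS fp_ae => x /(_ I) [] /eqP.
  rewrite mulf_eq0 gt_eqF; last by case/andP: (fK x).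
  by move=> /eqP ->.
Qed.

End pdf.

(** * The approximate posteriors *)

Section posteriors.
Context {R : realType} (n r s : nat) (Pi : 'M[R]_n).
Variables (V_r : 'M[R]_(n, r)) (V_perp : 'M[R]_(n, s)).
Variables (prior : 'cV[R]_n -> R) (cond_pdf : 'cV[R]_r -> 'cV[R]_s -> R).
Hypotheses (PiPi : Pi *m Pi = Pi) (hV_r : basis_of_image V_r Pi)
  (hV_perp : basis_of_kernel V_perp Pi).
Hypotheses (prior_pdf : is_pdf prior)
  (hcond : is_conditional_pdf Pi V_r V_perp prior cond_pdf).
Variables (L : 'cV[R]_n -> R) (K : R).
Hypotheses (mL : measurable_fun [set: 'cV[R]_n] L)
  (LK : forall x, 0 < L x <= K).

Local Notation z_r := (coord_r Pi V_r).
Local Notation z_perp := (coord_perp Pi V_perp).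
Local Notation leb := (lebesgue_cV n).
Local Notation Z := (evidence prior L).
Local Notation L_r := (marginal_likelihood V_r V_perp L cond_pdf).
Local Notation omega := (weight Pi V_r V_perp L cond_pdf).
Local Notation P := (posterior prior L).
Local Notation P_r := (approx_posterior Pi V_r V_perp prior L cond_pdf).
Local Notation cond_var := (cond_variance_weight Pi V_r V_perp L cond_pdf).

Let L_ge0 x : 0 <= L x. Proof. by case/andP: (LK x) => /ltW. Qed.

Let cond_pdf_pdf zr : is_pdf (cond_pdf zr). Proof. by case: hcond. Qed.

Let mprior : nnmeasurable prior.
Proof. by case: prior_pdf => mp p0 _; split. Qed.

Let measurable_z_r : measurable_fun [set: 'cV[R]_n] z_r.
Proof. exact: measurable_coords. Qed.

Let measurable_recompose d (T : measurableType d) (f : T -> 'cV[R]_r)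
    (g : T -> 'cV[R]_s) :
  measurable_fun [set: T] f -> measurable_fun [set: T] g ->
  measurable_fun [set: T] (fun t => L (V_r *m f t + V_perp *m g t)).
Proof.
move=> mf mg; apply: measurableT_comp; first exact: mL.
by apply: measurable_addmx; exact: measurable_mulmx.
Qed.

Lemma evidence_gt0 : 0 < Z.
Proof. by have [] := pdf_mean_gt0 prior_pdf mL LK. Qed.

Lemma evidenceE : (\int[leb]_x (L x * prior x)%:E = Z%:E)%E.
Proof. by have [] := pdf_mean_gt0 prior_pdf mL LK. Qed.

Let mLz zr :
  measurable_fun [set: 'cV[R]_s] (fun z => L (V_r *m zr + V_perp *m z)).
Proof. by apply: measurable_recompose. Qed.

Lemma marginal_likelihood_gt0 zr : 0 < L_r zr.
Proof. by have [] := pdf_mean_gt0 (cond_pdf_pdf zr) (mLz zr) (fun z => LK _). Qed.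

Lemma marginal_likelihoodE zr :
  (\int[lebesgue_cV s]_z (L (V_r *m zr + V_perp *m z) * cond_pdf zr z)%:E =
   (L_r zr)%:E)%E.
Proof. by have [] := pdf_mean_gt0 (cond_pdf_pdf zr) (mLz zr) (fun z => LK _). Qed.

Lemma measurable_marginal_likelihood : nnmeasurable L_r.
Proof.
split=> [|zr]; last exact/ltW/marginal_likelihood_gt0.
apply/measurable_EFinP; rewrite [X in measurable_fun _ X](_ : _ = fun zr =>
   (\int[lebesgue_cV s]_z (L (V_r *m zr + V_perp *m z) * cond_pdf zr z)%:E)%E);
  last by apply/funext => zr /=; rewrite marginal_likelihoodE.
apply: (measurable_fun_fubini_tonelli_F (fun y : 'cV[R]_r * 'cV[R]_s =>
  (L (V_r *m y.1 + V_perp *m y.2) * cond_pdf y.1 y.2)%:E)).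
  apply/measurable_EFinP; apply: measurable_funM; first exact: measurable_recompose.
  by case: hcond.
by move=> y; rewrite lee_fin mulr_ge0//; case: (cond_pdf_pdf y.1).
Qed.

(** Averages of functions of [z_r x] against the likelihood only see the
    marginal likelihood. *)
Lemma marginalization (g : 'cV[R]_r -> \bar R) :
  measurable_fun [set: 'cV[R]_r] g -> (forall zr, 0 <= g zr)%E ->
  (\int[leb]_x (g (z_r x) * (L x * prior x)%:E) =
   \int[leb]_x (g (z_r x) * (L_r (z_r x) * prior x)%:E))%E.
Proof.
move=> mg g0.
pose f (y : 'cV[R]_r * 'cV[R]_s) :=
  (g y.1 * (L (V_r *m y.1 + V_perp *m y.2))%:E)%E.
have mf : measurable_fun [set: 'cV[R]_r * 'cV[R]_s] f.
  apply: emeasurable_funM; first exact: (measurableT_comp mg measurable_fst).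
  by apply/measurable_EFinP; exact: measurable_recompose.
have f0 y : (0 <= f y)%E by rewrite mule_ge0// lee_fin.
transitivity (\int[leb]_x (f (z_r x, z_perp x) * (prior x)%:E))%E.
  by apply: eq_integral => x _; rewrite /f/= coord_decomposition// EFinM muleA.
rewrite (conditional_pdf_integral prior_pdf hcond mf f0).
apply: eq_integral => x _; rewrite EFinM muleA; congr (_ * _)%E.
have [mc c0 _] := cond_pdf_pdf (z_r x).
rewrite -marginal_likelihoodE -ge0_integralZl//.
- by apply: eq_integral => z _; rewrite /f/= EFinM muleA.
- by apply/measurable_EFinP; apply: measurable_funM.
- by move=> z _; rewrite lee_fin mulr_ge0.
Qed.

Lemma nnmeasurable_posterior : nnmeasurable P.
Proof.
apply: nnmeasurableM; last by split => // x; rewrite invr_ge0 ltW// evidence_gt0.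
by apply: nnmeasurableM.
Qed.

Lemma nnmeasurable_approx_posterior : nnmeasurable P_r.
Proof.
apply: nnmeasurableM; last by split => // x; rewrite invr_ge0 ltW// evidence_gt0.
apply: nnmeasurableM => //; split; last first.
  by move=> x; exact/ltW/marginal_likelihood_gt0.
exact: (measurableT_comp measurable_marginal_likelihood.1 measurable_z_r).
Qed.

Lemma marginalization_posterior (g : 'cV[R]_r -> \bar R) :
  measurable_fun [set: 'cV[R]_r] g -> (forall zr, 0 <= g zr)%E ->
  (\int[leb]_x (g (z_r x) * (P x)%:E) =
   \int[leb]_x (g (z_r x) * (P_r x)%:E))%E.
Proof.
move=> mg g0; pose g' zr := (g zr * (Z^-1)%:E)%E.
have ZV0 : (0 <= (Z^-1)%:E)%E by rewrite lee_fin invr_ge0 ltW// evidence_gt0.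
have mg' : measurable_fun [set: 'cV[R]_r] g' by exact: emeasurable_funM.
have g'0 zr : (0 <= g' zr)%E by exact: mule_ge0.
transitivity (\int[leb]_x (g' (z_r x) * (L x * prior x)%:E))%E.
  by apply: eq_integral => x _; rewrite -muleA; congr (_ * _)%E; rewrite muleC.
rewrite (marginalization mg' g'0); apply: eq_integral => x _.
by rewrite -muleA; congr (_ * _)%E; rewrite muleC.
Qed.

Lemma posterior_integral : (\int[leb]_x (P x)%:E = 1)%E.
Proof.
have Z0 := evidence_gt0; transitivity (\int[leb]_x (Z^-1 * (L x * prior x))%:E)%E.
  by apply: eq_integral => x _; rewrite mulrC.
rewrite nn_integralZ ?invr_ge0 ?(ltW Z0)//; last exact: nnmeasurableM.
by rewrite evidenceE -EFinM mulVf// gt_eqF.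
Qed.

Lemma approx_posterior_integral : (\int[leb]_x (P_r x)%:E = 1)%E.
Proof.
rewrite -posterior_integral.
transitivity (\int[leb]_x (cst 1 (z_r x) * (P_r x)%:E))%E.
  by apply: eq_integral => x _; rewrite /= mul1e.
rewrite -(marginalization_posterior (measurable_cst _)).
  by apply: eq_integral => x _; rewrite /= mul1e.
by move=> zr; exact: lee01.
Qed.

Lemma posterior_weight x : P x = omega x * P_r x.
Proof.
rewrite /posterior /weight /approx_posterior !mulrA; congr (_ / _).
by rewrite divfK// gt_eqF// marginal_likelihood_gt0.
Qed.

(** The Hellinger affinity of the posterior and the approximate posterior *)
Definition affinity := \int[leb]_x Num.sqrt (P x * P_r x).

Let maff : nnmeasurable (fun x => Num.sqrt (P x * P_r x)).
Proof.
apply/nnmeasurable_sqrt/nnmeasurableM; first exact: nnmeasurable_posterior.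
exact: nnmeasurable_approx_posterior.
Qed.

Lemma affinityE : (\int[leb]_x (Num.sqrt (P x * P_r x))%:E = affinity%:E)%E.
Proof.
have mp := nnmeasurable_posterior; have mq := nnmeasurable_approx_posterior.
rewrite /affinity /Rintegral fineK// ge0_fin_numE; last exact: nn_integral_ge0.
apply: (@le_lt_trans _ _ (\int[leb]_x (P x + P_r x)%:E)%E).
  apply: nn_integral_le => //; first exact: nnmeasurableD.
  move=> x; have p0 := mp.2 x; have q0 := mq.2 x.
  rewrite -[leRHS]ger0_norm ?addr_ge0// -sqrtr_sqr ler_sqrt ?sqr_ge0//.
  by nra.
by rewrite nn_integralD// posterior_integral approx_posterior_integral ltry.
Qed.

Lemma affinity_ge0 : 0 <= affinity.
Proof. by rewrite -lee_fin -affinityE; exact: nn_integral_ge0. Qed.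

Lemma variance_sqrt_weight :
  pdf_variance P_r (fun x => Num.sqrt (omega x)) = (1 - affinity ^+ 2)%:E.
Proof.
have mp := nnmeasurable_posterior; have mq := nnmeasurable_approx_posterior.
have o0 x : 0 <= omega x.
  by rewrite divr_ge0// ltW// marginal_likelihood_gt0.
have sqrtE x : Num.sqrt (omega x) * P_r x = Num.sqrt (P x * P_r x).
  rewrite posterior_weight -mulrA [RHS]sqrtrM// -expr2 sqrtr_sqr.
  by rewrite ger0_norm// mq.2.
have mo : nnmeasurable omega.
  apply: nnmeasurableM; first by split.
  apply: nnmeasurableV; split; last by move=> x; exact/ltW/marginal_likelihood_gt0.
  exact: (measurableT_comp measurable_marginal_likelihood.1 measurable_z_r).
rewrite /pdf_variance.
have -> : pdf_expectation P_r (EFin \o (fun x => Num.sqrt (omega x))) =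
    affinity%:E.
  by rewrite -affinityE; apply: eq_integral => x _; rewrite /= -EFinM sqrtE.
rewrite /= /pdf_expectation; set G := affinity.
have G0 : 0 <= G := affinity_ge0.
have G20 : 0 <= 2 * G by rewrite mulr_ge0.
have mv : nnmeasurable (fun x => (Num.sqrt (omega x) - G) ^+ 2 * P_r x).
  apply: nnmeasurableM => //; split; last by move=> x; exact: sqr_ge0.
  apply: measurable_funX; apply: measurable_funB => //.
  by case: (nnmeasurable_sqrt mo).
have := nn_integralD leb mv (nnmeasurableZ G20 maff).
under eq_integral => x _.
  rewrite (_ : _ + _ = P x + G ^+ 2 * P_r x).
    over.
  rewrite -sqrtE posterior_weight -[in omega x * _](sqr_sqrtr (o0 x)).
  by ring.
rewrite nn_integralD//; last exact: nnmeasurableZ (sqr_ge0 _) _.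
rewrite !nn_integralZ ?sqr_ge0// affinityE posterior_integral.
rewrite approx_posterior_integral mule1.
under [in RHS]eq_integral do rewrite EFinM.
case: (\int[_]_x _)%E => [v| |]//.
rewrite -EFinM -!EFinD => -[vE]; congr EFin.
by rewrite -[v](addrK (2 * G * G)) -vE; ring.
Qed.

End posteriors.

(** * The Monte Carlo posterior *)

Section monte_carlo.
Context {R : realType} (n r s N : nat) (Pi : 'M[R]_n).
Variables (V_r : 'M[R]_(n, r)) (V_perp : 'M[R]_(n, s)).
Variables (prior : 'cV[R]_n -> R) (cond_pdf : 'cV[R]_r -> 'cV[R]_s -> R).
Hypotheses (PiPi : Pi *m Pi = Pi) (hV_r : basis_of_image V_r Pi)
  (hV_perp : basis_of_kernel V_perp Pi).
Hypotheses (prior_pdf : is_pdf prior)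
  (hcond : is_conditional_pdf Pi V_r V_perp prior cond_pdf).
Variables (L : 'cV[R]_n -> R) (K : R).
Hypotheses (mL : measurable_fun [set: 'cV[R]_n] L)
  (LK : forall x, 0 < L x <= K).
Context (d : measure_display) (Omega : measurableType d).
Variables (MC : probability Omega R)
  (draws : Omega -> 'cV[R]_r -> N.-tuple 'cV[R]_s).
Hypotheses (N_gt0 : (0 < N)%N)
  (mdraws : measurable_fun [set: Omega * 'cV[R]_r]
     (fun y : Omega * 'cV[R]_r => draws y.1 y.2))
  (draws_iid : forall zr,
     iid_pdf MC (fun i w => tnth (draws w zr) i) (cond_pdf zr)).

Local Notation z_r := (coord_r Pi V_r).
Local Notation leb := (lebesgue_cV n).
Local Notation Z := (evidence prior L).
Local Notation L_r := (marginal_likelihood V_r V_perp L cond_pdf).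
Local Notation L_N := (fun w => mc_likelihood V_r V_perp L (draws w)).
Local Notation omega := (weight Pi V_r V_perp L cond_pdf).
Local Notation P := (posterior prior L).
Local Notation P_r := (approx_posterior Pi V_r V_perp prior L cond_pdf).
Local Notation P_N :=
  (fun w => mc_posterior Pi V_r V_perp prior L (draws w)).
Local Notation cond_var := (cond_variance_weight Pi V_r V_perp L cond_pdf).

Let Z0 : 0 < Z := evidence_gt0 prior_pdf mL LK.
Let L_r0 zr : 0 < L_r zr := marginal_likelihood_gt0 hcond mL LK zr.
Let L_ge0 x : 0 <= L x. Proof. by case/andP: (LK x) => /ltW. Qed.

Let mdraw i : measurable_fun [set: Omega * 'cV[R]_r]
  (fun y : Omega * 'cV[R]_r => tnth (draws y.1 y.2) i).
Proof. exact: (measurableT_comp (measurable_tnth i) mdraws). Qed.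

Let mdraw_at zr i : measurable_fun [set: Omega] (fun w => tnth (draws w zr) i).
Proof. exact: (measurableT_comp (mdraw i) (measurable_pair2 zr)). Qed.

Let mc_likelihood_bounds w zr : 0 < L_N w zr <= K.
Proof.
have N0 : 0 < N%:R :> R by rewrite ltr0n.
rewrite /mc_likelihood; apply/andP; split.
  rewrite mulr_gt0 ?invr_gt0// (bigD1 (Ordinal N_gt0))//=.
  rewrite ltr_pwDl ?sumr_ge0//; by case/andP: (LK (V_r *m zr +
    V_perp *m tnth (draws w zr) (Ordinal N_gt0))).
rewrite ler_pdivrMl// mulr_natl -[N in leRHS]card_ord -sumr_const.
by apply: ler_sum => i _; case/andP: (LK (V_r *m zr +
    V_perp *m tnth (draws w zr) i)).
Qed.

Let mL_N : nnmeasurable (fun y : Omega * 'cV[R]_r => L_N y.1 y.2).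
Proof.
split=> [|y]; last by case/andP: (mc_likelihood_bounds y.1 y.2) => /ltW.
apply: measurable_funM => //; apply: measurable_sum => i.
apply: measurableT_comp; first exact: mL.
by apply: measurable_addmx; apply: measurable_mulmx.
Qed.

(** The ratio of the Monte Carlo likelihood to the marginal likelihood *)
Let W w zr := L_N w zr / L_r zr.

Let mW : nnmeasurable (fun y : Omega * 'cV[R]_r => W y.1 y.2).
Proof.
apply: nnmeasurableM => //; apply: nnmeasurableV; split; last by move=> y; exact/ltW.
have [mLr _] := measurable_marginal_likelihood hcond mL LK.
exact: (measurableT_comp mLr measurable_snd).
Qed.

Section fixed_coordinate.
Variable zr : 'cV[R]_r.

Let h z := omega (V_r *m zr + V_perp *m z).

Let hE z : h z = (L_r zr)^-1 * L (V_r *m zr + V_perp *m z).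
Proof. by rewrite /h /weight coord_rK// mulrC. Qed.

Let W_mean w : W w zr = N%:R^-1 * \sum_(i < N) h (tnth (draws w zr) i).
Proof.
under eq_bigr do rewrite hE.
by rewrite -mulr_sumr mulrCA mulrC.
Qed.

Let h_bounds z : 0 < h z <= (L_r zr)^-1 * K.
Proof.
have /andP[L0 LleK] := LK (V_r *m zr + V_perp *m z).
by rewrite hE mulr_gt0 ?invr_gt0// ler_wpM2l// invr_ge0 ltW.
Qed.

Let mh : measurable_fun [set: 'cV[R]_s] h.
Proof.
rewrite (_ : h = fun z => (L_r zr)^-1 * L (V_r *m zr + V_perp *m z));
  last by apply/funext => z; exact: hE.
apply: measurable_funM => //; apply: measurableT_comp; first exact: mL.
by apply: measurable_addmx => //; exact: measurable_mulmx.
Qed.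

Let h0 z : 0 <= h z. Proof. by case/andP: (h_bounds z) => /ltW. Qed.

Let cond_pdf_pdf : is_pdf (cond_pdf zr). Proof. by case: hcond. Qed.

Let h_int : (\int[lebesgue_cV s]_z (h z * cond_pdf zr z)%:E = 1)%E.
Proof.
have [mc c0 _] := cond_pdf_pdf.
under eq_integral do rewrite hE -mulrA.
rewrite nn_integralZ ?invr_ge0 ?(ltW (L_r0 zr))//; last first.
  apply: nnmeasurableM; split => //; apply: measurableT_comp; first exact: mL.
  by apply: measurable_addmx => //; exact: measurable_mulmx.
by rewrite (marginal_likelihoodE hcond mL LK) -EFinM mulVf// gt_eqF.
Qed.

Lemma relative_likelihood_mean : (\int[MC]_w (W w zr)%:E = 1)%E.
Proof.
under eq_integral do rewrite W_mean.
exact: (sample_mean_integral N_gt0 (mdraw_at zr) (draws_iid zr) cond_pdf_pdf).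
Qed.

Lemma relative_likelihood_variance :
  (\int[MC]_w ((W w zr - 1) ^+ 2)%:E = (N%:R^-1)%:E * cond_var zr)%E.
Proof.
under eq_integral do rewrite W_mean.
have [] := @pdf_mean_gt0 _ _ _ cond_pdf_pdf (fun z => h z ^+ 2)
  (((L_r zr)^-1 * K) ^+ 2).
- exact: measurable_funX.
- move=> z; have /andP[hz0 hzK] := h_bounds z.
  by rewrite exprn_gt0// lerXn2r// nnegrE ltW// (lt_le_trans hz0).
move=> h2 _.
exact: (sample_mean_variance N_gt0 (mdraw_at zr) (draws_iid zr) cond_pdf_pdf
  mh h0 h_int h2).
Qed.

End fixed_coordinate.

Let T w := (\int[leb]_x (L_N w (z_r x) * prior x)) / Z.

Let measurable_z_r : measurable_fun [set: 'cV[R]_n] z_r.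
Proof. exact: measurable_coords. Qed.

Let mL_Nx w : measurable_fun [set: 'cV[R]_n] (fun x => L_N w (z_r x)).
Proof.
apply: (measurableT_comp _ measurable_z_r).
exact: (measurableT_comp mL_N.1 (measurable_pair1 w)).
Qed.

Let mc_evidence_gt0 w : 0 < \int[leb]_x (L_N w (z_r x) * prior x).
Proof.
by have [] := pdf_mean_gt0 prior_pdf (mL_Nx w) (fun x => mc_likelihood_bounds w _).
Qed.

Let T0 w : 0 < T w. Proof. exact: divr_gt0. Qed.

Let WP_r w x : W w (z_r x) * P_r x = Z^-1 * (L_N w (z_r x) * prior x).
Proof.
rewrite /W /approx_posterior mulrA mulrA divfK ?gt_eqF//.
by rewrite mulrC.
Qed.

Let TE w : (\int[leb]_x (W w (z_r x) * P_r x)%:E = (T w)%:E)%E.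
Proof.
under eq_integral do rewrite WP_r.
have [LNE _] :=
  pdf_mean_gt0 prior_pdf (mL_Nx w) (fun x => mc_likelihood_bounds w _).
rewrite nn_integralZ ?invr_ge0 ?(ltW Z0)//; last first.
  apply: nnmeasurableM; last by case: prior_pdf => mp p0 _; split.
  by split => // x; case/andP: (mc_likelihood_bounds w (z_r x)) => /ltW.
by rewrite LNE -EFinM mulrC.
Qed.

Let mc_posteriorE w x : P_N w x = W w (z_r x) * P_r x / T w.
Proof.
rewrite WP_r /mc_posterior /T invfM invrK.
by field; rewrite gt_eqF ?Z0// gt_eqF ?mc_evidence_gt0.
Qed.

Let cond_varE zr : cond_var zr = (N%:R%:E * \int[MC]_w ((W w zr - 1) ^+ 2)%:E)%E.
Proof.
rewrite relative_likelihood_variance muleA -EFinM divff ?mul1e//.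
by rewrite pnatr_eq0 -lt0n.
Qed.

Local Notation G := (affinity Pi V_r V_perp prior cond_pdf L).

Let mv : measurable_fun [set: 'cV[R]_r]
  (fun zr => \int[MC]_w ((W w zr - 1) ^+ 2)%:E)%E.
Proof.
apply: (measurable_fun_fubini_tonelli_G (fun y : Omega * 'cV[R]_r =>
  ((W y.1 y.2 - 1) ^+ 2)%:E)).
  by apply/measurable_EFinP; case: (nnmeasurable_sqrB1 mW).
by move=> y; rewrite lee_fin sqr_ge0.
Qed.

Let v0 zr : (0 <= \int[MC]_w ((W w zr - 1) ^+ 2)%:E)%E.
Proof. by apply: integral_ge0 => w _; rewrite lee_fin sqr_ge0. Qed.

Lemma expected_hellinger_mc_posterior :
  (\int[MC]_w hellinger_sq P (P_N w) + G%:E <=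
   1 + \int[leb]_x ((\int[MC]_w ((W w (z_r x) - 1) ^+ 2)%:E) * (P_r x)%:E))%E.
Proof.
have mP := nnmeasurable_posterior prior_pdf mL LK.
have mP_r := nnmeasurable_approx_posterior prior_pdf hcond mL LK.
have mWx : nnmeasurable (fun y : Omega * 'cV[R]_n => W y.1 (z_r y.2)).
  split=> [|y]; last exact: mW.2 (y.1, z_r y.2).
  apply: (measurableT_comp mW.1 (_ : measurable_fun _ (fun y => (y.1, z_r y.2)))).
  apply: measurable_fun_pair => //.
  exact: (measurableT_comp measurable_z_r measurable_snd).
have pvE := marginalization_posterior PiPi hV_r hV_perp prior_pdf hcond mL LK
  mv v0.
have := expected_hellinger_reweighted mP mP_r mWx
  (posterior_integral prior_pdf mL LK)
  (approx_posterior_integral PiPi hV_r hV_perp prior_pdf hcond mL LK)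
  (affinityE PiPi hV_r hV_perp prior_pdf hcond mL LK)
  (fun x => relative_likelihood_mean (z_r x)) T0 TE pvE.
apply: le_trans; apply: leeD => //; rewrite le_eqVlt; apply/orP; left; apply/eqP.
apply: eq_integral => w _; rewrite /hellinger_sq -nn_integralZ//.
  by apply: eq_integral => x _; rewrite mc_posteriorE.
split; last by move=> x; exact: sqr_ge0.
under eq_fun do rewrite mc_posteriorE.
have mWw : nnmeasurable (fun x => W w (z_r x)).
  split=> [|x]; last exact: mW.2 (w, z_r x).
  exact: (measurableT_comp mWx.1 (measurable_pair1 w)).
have mWq := nnmeasurableM mWw mP_r.
have mWqT : nnmeasurable (fun x => W w (z_r x) * P_r x / T w).
  by apply: nnmeasurableM => //; split => // x; rewrite invr_ge0 ltW.
apply: measurable_funX; apply: measurable_funB.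
  by case: (nnmeasurable_sqrt mP).
by case: (nnmeasurable_sqrt mWqT).
Qed.

(** The last expectation is [N] times the mean variance of [W], so the factor
    [2 / N] leaves room to spare. *)
Lemma expected_hellinger_le :
  (\int[MC]_w hellinger_sq P (P_N w) <=
     1 - sqrte (1 - pdf_variance P_r (fun x => Num.sqrt (omega x)))
     + (2 / N%:R)%:E * pdf_expectation P_r (fun x => cond_var (z_r x)))%E.
Proof.
have := expected_hellinger_mc_posterior.
set V := (\int[leb]_x _)%E; set E := (\int[MC]_w _)%E => EV.
have [mP_r P_r0] := nnmeasurable_approx_posterior prior_pdf hcond mL LK.
have vP_r0 x : (0 <=
    (\int[MC]_w ((W w (z_r x) - 1) ^+ 2)%:E) * (P_r x)%:E)%E.
  by rewrite mule_ge0// lee_fin.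
have V0 : (0 <= V)%E by exact: integral_ge0.
have -> : (pdf_expectation P_r (fun x => cond_var (z_r x)) = N%:R%:E * V)%E.
  rewrite /V -ge0_integralZl//.
    by apply: eq_integral => x _; rewrite cond_varE muleA.
  apply: emeasurable_funM; last exact/measurable_EFinP.
  exact: (measurableT_comp mv measurable_z_r).
have G0 := affinity_ge0 PiPi hV_r hV_perp prior_pdf hcond mL LK.
rewrite (variance_sqrt_weight PiPi hV_r hV_perp prior_pdf hcond mL LK).
rewrite -EFinB opprB addrC subrK /= sqrtr_sqr ger0_norm//.
rewrite muleA -EFinM divfK ?pnatr_eq0 -?lt0n//.
case: V V0 EV => [v| |]//; last first.
  by move=> _ _; rewrite gt0_muley ?lte_fin// addey ?leey.
case: E => [e| |]//; last by move=> _ _; exact: leNye.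
by rewrite -EFinM -!EFinD !lee_fin; lra.
Qed.

End monte_carlo.

Theorem mainTheorem3 (R : realType) (n m r N : nat)
  (hr : (1 <= r < n)%N) (hN : (1 <= N)%N)
  (F : 'cV[R]_n -> 'cV[R]_m) (hF : measurable_fun setT F)
  (C : 'M[R]_m) (hC : symmetric_posdef C) (Y : 'cV[R]_m)
  (prior : 'cV[R]_n -> R) (hprior : is_pdf prior)
  (Pi : 'M[R]_n) (hPi : Pi *m Pi = Pi) (hrank : \rank Pi = r)
  (V_r : 'M[R]_(n, r)) (hV_r : basis_of_image V_r Pi)
  (V_perp : 'M[R]_(n, n - r)) (hV_perp : basis_of_kernel V_perp Pi)
  (cond_pdf : 'cV[R]_r -> 'cV[R]_(n - r) -> R)
  (hcond : is_conditional_pdf Pi V_r V_perp prior cond_pdf)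
  (d : measure_display) (Omega : measurableType d) (MC : probability Omega R)
  (draws : Omega -> 'cV[R]_r -> N.-tuple 'cV[R]_(n - r))
  (hdraws : measurable_fun setT
     (fun p : Omega * 'cV[R]_r => draws p.1 p.2))
  (hiid : forall zr : 'cV[R]_r,
     iid_pdf MC (fun i w => tnth (draws w zr) i) (cond_pdf zr)) :
  let L := likelihood F C Y in
  let P := posterior prior L in
  let P_r := approx_posterior Pi V_r V_perp prior L cond_pdf in
  let P_rN w := mc_posterior Pi V_r V_perp prior L (draws w) in
  let omega := weight Pi V_r V_perp L cond_pdf in
  let cond_var := cond_variance_weight Pi V_r V_perp L cond_pdf in
  (\int[MC]_w hellinger_sq P (P_rN w) <=
     1 - sqrte (1 - pdf_variance P_r (fun x => Num.sqrt (omega x)))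
     + (2 / N%:R)%:E *
       pdf_expectation P_r (fun x => cond_var (coord_r Pi V_r x)))%E.
Proof.
have [K LK] := likelihood_bounded F Y hC.
cbv zeta.
apply: (expected_hellinger_le (K := K) hPi hV_r hV_perp hprior hcond) => //.
- exact: measurable_likelihood.
- by move=> x; rewrite likelihood_gt0//= LK.
Qed.
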